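(* Let $n\ge 2$, let $I\subset R$ be a complete intersection of codimension $n$ with homogeneous generators of degrees $d_1\le\cdots\le d_n$, let $K\subset I$ be generated by a homogeneous regular sequence of length $n$ with degrees $e_1\le\cdots\le e_n$, let $J=(K:I)$, and assume that the dual mapping cone resolution $\mathbf P$ of $R/J$ (described in the context) is minimal. If $$\sum_{i=2}^n(e_i-e_1)\ge d_1,$$ then $$e(R/J)\le \frac{\prod_{i=1}^n M_i}{n!},$$ where $M_i$ is the maximal shift in the $i$-th step of the minimal graded free resolution of $R/J$.
   Context: $R$ is a standard graded polynomial ring over a field, and $e(R/J)$ denotes the multiplicity of $R/J$. Put $\alpha=\sum_{i=1}^n e_i$. The inclusion $K\subset I$ induces a map $\phi$ from the Koszul resolution of $R/K$ to the Koszul resolution of $R/I$; the mapping cone of its dual (with the identity component in homological degree $0$ of $\phi$ cancelled) is a graded free resolution $\mathbf P$ of $R/J$ with $P_0=R$, $$P_i=\bigoplus_{|S|=i}R\Big(-\sum_{t\in S}e_t\Big)\oplus\bigoplus_{|T|=n-i+1}R\Big(-\big(\alpha-\sum_{t\in T}d_t\big)\Big)\quad(1\le i\le n-1),\qquad P_n=\bigoplus_{t=1}^nR(-(\alpha-d_t)),$$ where $S,T$ range over subsets of $\{1,\dots,n\}$. When $\mathbf P$ is minimal, the maximal shifts are $M_i=\max\{\sum_{t\ge n-i+1}e_t,\ \alpha-\sum_{t\le n-i+1}d_t\}$ for $1\le i\le n-1$ and $M_n=\alpha-d_1$. *)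

(* Defs.v *)
From HB Require Import structures.
From mathcomp Require Import all_boot all_order all_algebra.
From mathcomp.multinomials Require Import mpoly.
From Stdlib Require Import ClassicalEpsilon.

Set Implicit Arguments.
Unset Strict Implicit.
Unset Printing Implicit Defensive.

Import Order.TTheory GRing.Theory Num.Theory.
Local Open Scope ring_scope.

Section Ideals.
Variables (k : fieldType) (m : nat).
Local Notation R := {mpoly k[m]}.

Definition span (n : nat) (P : pred 'I_n) (f : 'I_n -> R) (p : R) : Prop :=
  exists c : 'I_n -> R, p = \sum_(i < n | P i) c i * f i.

Definition ideal (n : nat) (f : 'I_n -> R) : R -> Prop := span predT f.

Definition colon (K I : R -> Prop) (p : R) : Prop :=
  forall q : R, I q -> K (p * q).

Definition regular_sequence (n : nat) (f : 'I_n -> R) : Prop :=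
  (forall (i : 'I_n) (p : R),
      span (fun j : 'I_n => (j < i)%N) f (p * f i) ->
      span (fun j : 'I_n => (j < i)%N) f p)
  /\ ~ ideal f 1.

(* In R a homogeneous ideal of codimension n generated by n homogeneous
   elements is the same thing as one generated by a homogeneous regular
   sequence of length n; the latter is the definition used here.  The
   homogeneous sequence f has degrees d_0, ..., d_(n-1), and d_i > 0 follows
   from properness. *)
Definition homogeneous_regular_sequence (n : nat) (d : 'I_n -> nat)
    (f : 'I_n -> R) : Prop :=
  (forall i, f i \is (d i).-homog) /\ regular_sequence f.

(* Membership of p in the graded piece R_z; R_z = 0 for z < 0. *)
Definition homog_of_deg (z : int) (p : R) : Prop :=
  forall u : 'X_{1..m}, u \in msupp p -> (mdeg u)%:Z = z.

End Ideals.

Section Multiplicity.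
Variables (k : fieldType) (m : nat).
Local Notation R := {mpoly k[m]}.

(* h = dim_k (R/J)_t: some h elements of R_t induce a basis of R_t/(J n R_t). *)
Definition is_graded_dim (J : R -> Prop) (t h : nat) : Prop :=
  exists b : 'I_h -> R,
    (forall i, b i \is t.-homog) /\
    (forall p : R, p \is t.-homog ->
       exists! c : {ffun 'I_h -> k}, J (p - \sum_(i < h) c i *: b i)).

(* With Hilbert polynomial Q of degree D - 1, where D = dim R/J, the
   multiplicity is (D-1)! times the leading coefficient of Q if D > 0, and
   the length of R/J if D <= 0, i.e. if Q = 0. *)
Definition is_multiplicity (J : R -> Prop) (mu : nat) : Prop :=
  exists (H : nat -> nat) (Q : {poly rat}) (t0 : nat),
    [/\ forall t, is_graded_dim J t (H t),
        forall t, (t0 <= t)%N -> (H t)%:R = Q.[t%:R]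
      & if Q == 0 then mu = (\sum_(t < t0) H t)%N
        else mu%:R = lead_coef Q * ((size Q).-1)`!%:R].

Definition multiplicity (J : R -> Prop) : nat :=
  epsilon (inhabits 0%N) (is_multiplicity J).

End Multiplicity.

(* A graded free module of finite rank with a homological grading: gen is a
   homogeneous basis, hdeg the homological degree, and b generates a copy of
   R(- gshift b).  The differential is given by its matrix:
   d(a) = \sum_b gdiff a b * b. *)
Record graded_free (k : fieldType) (m : nat) := GradedFree {
  gen :> finType;
  hdeg : gen -> nat;
  gshift : gen -> int;
  gdiff : gen -> gen -> {mpoly k[m]} }.

Section Complexes.
Variables (k : fieldType) (m : nat).
Local Notation R := {mpoly k[m]}.
Implicit Types C D : graded_free k m.

Definition is_complex C : Prop :=
  [/\ forall a b : C, hdeg a <> (hdeg b).+1 -> gdiff a b = 0,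
      forall a b : C, homog_of_deg (gshift a - gshift b) (gdiff a b)
    & forall a c : C, \sum_(b : C) gdiff a b * gdiff b c = 0].

Definition in_step C (i : nat) (v : {ffun C -> R}) : Prop :=
  forall b : C, hdeg b <> i -> v b = 0.

Definition bd C (v : {ffun C -> R}) : {ffun C -> R} :=
  [ffun b : C => \sum_(a : C) v a * gdiff a b].

(* The augmentation C_0 -> R/J is induced by b |-> class of eps b. *)
Definition is_free_resolution (J : R -> Prop) C : Prop :=
  [/\ is_complex C,
      forall (i : nat) (v : {ffun C -> R}), in_step i.+1 v -> bd v = 0 ->
        exists2 w : {ffun C -> R}, in_step i.+2 w & v = bd w
    & exists eps : C -> R,
        [/\ forall b : C, hdeg b = 0%N -> homog_of_deg (gshift b) (eps b),
            exists2 v : {ffun C -> R},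
              in_step 0 v & J (1 - \sum_(b : C) v b * eps b)
          & forall v : {ffun C -> R}, in_step 0 v ->
              (J (\sum_(b : C) v b * eps b) <->
               exists2 w : {ffun C -> R}, in_step 1 w & v = bd w)]].

(* All matrix entries lie in the homogeneous maximal ideal of R. *)
Definition is_minimal C : Prop :=
  forall a b : C, (gdiff a b)@_0%MM = 0.

Definition is_minimal_free_resolution (J : R -> Prop) C : Prop :=
  is_free_resolution J C /\ is_minimal C.

Definition is_max_shift C (i : nat) (M : int) : Prop :=
  (exists2 b : C, hdeg b = i & gshift b = M) /\
  (forall b : C, hdeg b = i -> gshift b <= M).

(* phi a b is the coefficient of b in the image of a. *)
Definition is_chain_map C D (phi : C -> D -> R) : Prop :=
  [/\ forall (a : C) (b : D), hdeg a <> hdeg b -> phi a b = 0,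
      forall (a : C) (b : D), homog_of_deg (gshift a - gshift b) (phi a b)
    & forall (a : C) (b : D),
        \sum_(c : C) gdiff a c * phi c b = \sum_(c : D) phi a c * gdiff c b].

End Complexes.

Section DualCone.
Variables (k : fieldType) (m n : nat).
Local Notation R := {mpoly k[m]}.

(* e_S |-> \sum_(t in S) (-1)^(number of s in S with s < t) f_t e_(S - t) *)
Definition koszul_diff (f : 'I_n -> R) (S T : {set 'I_n}) : R :=
  \sum_(t in S | T == S :\ t) (-1) ^+ #|[set s in S | (s < t)%N]| * f t.

Definition koszul (d : 'I_n -> nat) (f : 'I_n -> R) : graded_free k m :=
  @GradedFree k m {set 'I_n}
    (fun S => #|S|) (fun S => (\sum_(t in S) d t)%N%:Z) (koszul_diff f).

(* A lift to the Koszul complexes of the surjection R/(g) -> R/(f) given by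
   (g) \subset (f); it is determined only up to homotopy. *)
Definition lifts_inclusion (d e : 'I_n -> nat) (f g : 'I_n -> R)
    (phi : {set 'I_n} -> {set 'I_n} -> R) : Prop :=
  is_chain_map (C := koszul e g) (D := koszul d f) phi /\ phi set0 set0 = 1.

(* The mapping cone of phi^* : koszul(f)^* -> koszul(g)^*, twisted by -alpha,
   with homological degree n - j in place of cohomological degree j for
   koszul(g)^* and n - j + 1 for koszul(f)^*.
   - inl B is the dual basis element of e_(~: B) in koszul(g)^*, of shift
     alpha - \sum_(t notin B) e_t = \sum_(t in B) e_t;
   - inr T is the dual basis element of e_T in koszul(f)^*.
   The identity component phi set0 set0 maps inr set0 (degree n + 1) to
   inl setT (degree n).  Cancelling it removes these two generators and
   changes no other matrix entry, since inl setT is in the image of no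
   generator other than inr set0. *)
Definition cone_gen : finType :=
  ({B : {set 'I_n} | B != setT} + {T : {set 'I_n} | T != set0})%type.

Definition cone_hdeg (b : cone_gen) : nat :=
  match b with
  | inl B => #|val B|
  | inr T => (n.+1 - #|val T|)%N
  end.

Definition cone_shift (d e : 'I_n -> nat) (b : cone_gen) : int :=
  match b with
  | inl B => (\sum_(t in val B) e t)%N%:Z
  | inr T => (\sum_(t < n) e t)%N%:Z - (\sum_(t in val T) d t)%N%:Z
  end.

Definition cone_diff (f g : 'I_n -> R) (phi : {set 'I_n} -> {set 'I_n} -> R)
    (a b : cone_gen) : R :=
  match a, b with
  | inl B, inl B' => koszul_diff g (~: val B') (~: val B)
  | inl _, inr _ => 0
  | inr T, inl B => phi (~: val B) (val T)
  | inr T, inr T' => - koszul_diff f (val T') (val T)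
  end.

Definition dual_cone (d e : 'I_n -> nat) (f g : 'I_n -> R)
    (phi : {set 'I_n} -> {set 'I_n} -> R) : graded_free k m :=
  @GradedFree k m cone_gen cone_hdeg (cone_shift d e) (cone_diff f g phi).

End DualCone.

(* Main.v *)
Require Import Defs.
From HB Require Import structures.
From mathcomp Require Import all_boot all_order all_algebra.
From mathcomp.multinomials Require Import mpoly.
From mathcomp Require Import zify ring lra.
From Stdlib Require Import Classical ClassicalEpsilon.

Set Implicit Arguments.
Unset Strict Implicit.
Unset Printing Implicit Defensive.

Import Order.TTheory GRing.Theory Num.Theory.
Local Open Scope ring_scope.

(** Write K = (g), I = (f), J = K : I, let e_1 <= ... <= e_n be the degrees of
    the g_i, d_1 the least degree of the f_i and alpha the sum of the e_i.

    The numerical point is that the hypothesis says alpha - d_1 >= n e_1.  The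
    i-th step of the dual mapping cone, for i < n, contains a generator whose
    shift is the sum of the i largest e_t, hence is at least i e_(n-i+1); the
    n-th step contains one of shift alpha - d_1, hence at least n e_1.  So the
    product of the maximal shifts is at least n! e_1 ... e_n, and it suffices to
    show that the multiplicity of R/J is at most e_1 ... e_n.

    The shifts of the dual mapping cone P are those of any minimal resolution F
    once P is known to be a resolution ([dual_cone_resolution]): lifting the
    identity of R/J from P to F and back gives a map homotopic to the identity,
    and minimality of P turns the homotopy into a congruence modulo the maximal
    ideal ([minimal_resolution_shift]).  That P is a resolution is linkage.
    Re-indexing by complements identifies the dual of a Koszul complex with the
    Koszul complex of the same sequence up to signs ([koszul_diff_compl]), so P
    is the cone of a map between two resolutions, of R/I and of R/K, which in
    degree 0 is multiplication by delta, the top coefficient of phi.  Lifting a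
    multiplication map R/I -> R/K to the Koszul complexes and dualizing gives
    a lift of a multiplication map R/K -> R/I, and such lifts are unique up to
    homotopy; reading off the top coefficients yields that delta is injective
    from R/I to R/K ([link_injective]) and that J = K + (delta)
    ([link_colon]).

    The same two facts give the exact sequence 0 -> R/I -> R/K -> R/J -> 0, with
    a shift on R/I, and thereby the Hilbert function of R/J ([link_hilb]).  The
    Hilbert polynomial modulo a regular sequence comes from iterated differences
    ([hilbert_poly_initial]); in particular n is at most the number m of variables
    ([regular_length]).  If m = n, then R/J is a quotient of R/K, whose length
    is e_1 ... e_n.  If m > n, the leading coefficient of the Hilbert polynomial
    of R/J is a multiple of the difference
    e_1 ... e_n - d_1 ... d_n, which is the multiplicity as soon as it is
    nonzero.  It is positive: comparing Hilbert polynomials gives d_i <= e_i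
    ([degree_le]), and minimality of P forces d_1 < e_1 ([degree_lt]). *)

(** * Complexes of free modules, lifts and homotopies *)

Section Comparison.
Variables (k : fieldType) (m : nat).
Local Notation R := {mpoly k[m]}.
Implicit Types C D : graded_free k m.

(** Vectors are rows and a map of free modules is the family of the images of
    the basis, so maps act on the right of vectors and compose left to right. *)
Definition act (A B : finType) (v : {ffun A -> R}) (phi : A -> {ffun B -> R}) :
  {ffun B -> R} := [ffun b => \sum_a v a * phi a b].

Definition diff C (a : C) : {ffun C -> R} := [ffun b => gdiff a b].

Section Act.
Variables A B E : finType.
Implicit Types (v w : {ffun A -> R}) (phi : A -> {ffun B -> R}).

Lemma actD v w phi : act (v + w) phi = act v phi + act w phi.
Proof.
apply/ffunP => b; rewrite !ffunE -big_split; apply: eq_bigr => a _.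
by rewrite !ffunE mulrDl.
Qed.

Lemma actN v phi : act (- v) phi = - act v phi.
Proof.
apply/ffunP => b; rewrite !ffunE -sumrN; apply: eq_bigr => a _.
by rewrite !ffunE mulNr.
Qed.

Lemma actB v w phi : act (v - w) phi = act v phi - act w phi.
Proof. by rewrite actD actN. Qed.

Lemma act0 phi : act 0 phi = 0.
Proof. by apply/ffunP => b; rewrite !ffunE big1 // => a _; rewrite ffunE mul0r. Qed.

Lemma act_act v phi (psi : B -> {ffun E -> R}) :
  act (act v phi) psi = act v (fun a => act (phi a) psi).
Proof.
apply/ffunP => e; rewrite !ffunE.
under eq_bigr => b _ do rewrite ffunE mulr_suml.
rewrite exchange_big; apply: eq_bigr => a _; rewrite ffunE mulr_sumr.
by apply: eq_bigr => b _; rewrite mulrA.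
Qed.

Lemma eq_act v phi psi : (forall a, v a != 0 -> phi a = psi a) ->
  act v phi = act v psi.
Proof.
move=> e; apply/ffunP => b; rewrite !ffunE; apply: eq_bigr => a _.
by have [->|nz] := eqVneq (v a) 0; rewrite ?mul0r // e.
Qed.

Lemma act_addr v phi psi :
  act v (fun a => phi a + psi a) = act v phi + act v psi.
Proof.
apply/ffunP => b; rewrite !ffunE -big_split; apply: eq_bigr => a _.
by rewrite ffunE mulrDr.
Qed.

Lemma act_oppr v phi : act v (fun a => - phi a) = - act v phi.
Proof.
apply/ffunP => b; rewrite !ffunE -sumrN; apply: eq_bigr => a _.
by rewrite ffunE mulrN.
Qed.

End Act.

Lemma bdE C (v : {ffun C -> R}) : bd v = act v (@diff C).
Proof.
by apply/ffunP => b; rewrite !ffunE; apply: eq_bigr => a _; rewrite ffunE.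
Qed.

Lemma bdD C (v w : {ffun C -> R}) : bd (v + w) = bd v + bd w.
Proof. by rewrite !bdE actD. Qed.

Lemma bdB C (v w : {ffun C -> R}) : bd (v - w) = bd v - bd w.
Proof. by rewrite !bdE actB. Qed.

Lemma bdN C (v : {ffun C -> R}) : bd (- v) = - bd v.
Proof. by rewrite !bdE actN. Qed.

Lemma bd0 C : bd (0 : {ffun C -> R}) = 0.
Proof. by rewrite bdE act0. Qed.

Definition acyclic C : Prop :=
  forall (i : nat) (v : {ffun C -> R}), in_step i.+1 v -> bd v = 0 ->
    exists2 w : {ffun C -> R}, in_step i.+2 w & v = bd w.

Definition chain C : Prop :=
  (forall a b : C, hdeg a <> (hdeg b).+1 -> gdiff a b = 0) /\
  (forall a c : C, \sum_(b : C) gdiff a b * gdiff b c = 0).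

Definition chain_map C D (phi : C -> {ffun D -> R}) : Prop :=
  (forall a, in_step (hdeg a) (phi a)) /\
  (forall a, act (diff a) phi = bd (phi a)).

Lemma bd_diff C (a : C) : chain C -> bd (diff a) = 0.
Proof.
move=> [_ dd]; apply/ffunP => c; rewrite !ffunE -[RHS](dd a c).
by apply: eq_bigr => b _; rewrite ffunE.
Qed.

Lemma in_step_diff C (a : C) i : chain C -> hdeg a = i.+1 -> in_step i (diff a).
Proof.
move=> [dC _] ha b hb; rewrite ffunE dC // ha => -[] e.
by apply: hb.
Qed.

Lemma diff_bottom C (a : C) : chain C -> hdeg a = 0%N -> diff a = 0.
Proof. by move=> [dC _] ha; apply/ffunP => b; rewrite !ffunE dC // ha. Qed.

Lemma in_step_act C D (v : {ffun C -> R}) (phi : C -> {ffun D -> R}) i j :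
  in_step i v -> (forall a, hdeg a = i -> in_step j (phi a)) ->
  in_step j (act v phi).
Proof.
move=> sv sphi b hb; rewrite ffunE big1 // => a _.
by have [ha|/eqP ha] := eqVneq (hdeg a) i;
  [rewrite (sphi a ha b hb) mulr0|rewrite sv // mul0r].
Qed.

Lemma in_step_bd C (v : {ffun C -> R}) i : chain C -> in_step i.+1 v ->
  in_step i (bd v).
Proof.
by move=> cC sv; rewrite bdE; apply: in_step_act sv _ => a; apply: in_step_diff.
Qed.

Lemma bd_bottom C (v : {ffun C -> R}) : chain C -> in_step 0 v -> bd v = 0.
Proof.
move=> cC sv; apply/ffunP => b; rewrite bdE ffunE [RHS]ffunE big1 // => a _.
have [ha|/eqP ha] := eqVneq (hdeg a) 0%N; last by rewrite sv // mul0r.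
by rewrite diff_bottom // ffunE mulr0.
Qed.

Lemma in_stepB C (v w : {ffun C -> R}) i :
  in_step i v -> in_step i w -> in_step i (v - w).
Proof. by move=> sv sw b hb; rewrite !ffunE sv // sw // subr0. Qed.

Lemma in_stepD C (v w : {ffun C -> R}) i :
  in_step i v -> in_step i w -> in_step i (v + w).
Proof. by move=> sv sw b hb; rewrite !ffunE sv // sw // addr0. Qed.

Lemma in_stepN C (v : {ffun C -> R}) i : in_step i v -> in_step i (- v).
Proof. by move=> sv b hb; rewrite !ffunE sv // oppr0. Qed.

Lemma in_step_neq0 C (v : {ffun C -> R}) i a :
  in_step i v -> v a != 0 -> hdeg a = i.
Proof. by move=> sv; apply: contraNeq => /eqP /sv ->. Qed.

Lemma hdeg_le_max C (a : C) : (hdeg a <= \max_(b : C) hdeg b)%N.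
Proof. exact: leq_bigmax. Qed.

(** The comparison theorem.  Since the basis of C is finite, a partial lift
    defined up to homological degree N can be extended to degree N.+1 on all
    generators at once, and N = the largest degree ends the construction. *)
Lemma lift_chain_map C D (phi0 : C -> {ffun D -> R}) :
  chain C -> chain D -> acyclic D ->
  (forall a, hdeg a = 0%N -> in_step 0 (phi0 a)) ->
  (forall a, hdeg a = 1%N ->
     exists2 w, in_step 1 w & act (diff a) phi0 = bd w) ->
  exists2 phi, chain_map phi & forall a, hdeg a = 0%N -> phi a = phi0 a.
Proof.
move=> cC cD exD s0 l0.
suff [phi hphi e0] : exists2 phi : C -> {ffun D -> R},
    forall a, (hdeg a <= \max_(b : C) hdeg b)%N ->
      in_step (hdeg a) (phi a) /\ act (diff a) phi = bd (phi a)
    & forall a, hdeg a = 0%N -> phi a = phi0 a.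
  exists phi => //; split=> a; have [] := hphi a (hdeg_le_max a) => //.
elim: (\max_(b : C) _) => [|N [phi hphi e0]].
  exists phi0 => // a; rewrite leqn0 => /eqP ha; split; first by rewrite ha; apply: s0.
  by rewrite diff_bottom // act0 bd_bottom //; apply: s0.
have step (a : C) : exists w, hdeg a = N.+1 ->
    in_step N.+1 w /\ act (diff a) phi = bd w.
  have [ha|/eqP ha] := eqVneq (hdeg a) N.+1; last by exists 0.
  have sa := in_step_diff cC ha.
  have [N0|N_gt0] := posnP N.
    subst N; have [w sw ew] := l0 a ha; exists w => _; split => //.
    rewrite -ew; apply: eq_act => c nz; apply: e0; exact: in_step_neq0 sa nz.
  have eN : N = N.-1.+1 by rewrite prednK.
  have : exists2 w, in_step N.-1.+2 w & act (diff a) phi = bd w.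
    apply: exD; first rewrite -eN.
      by apply: (in_step_act sa) => c hc; have [] := hphi c; rewrite ?hc.
    rewrite bdE act_act (_ : act _ _ = act (diff a) (fun c => act (diff c) phi)).
      by rewrite -act_act -bdE bd_diff // act0.
    apply: eq_act => c nz; have hc := in_step_neq0 sa nz.
    by have [|_ ->] := hphi c; rewrite ?hc // bdE.
  by rewrite prednK // => -[w sw ew]; exists w.
have {step} [w hw] := fin_all_exists step.
exists (fun a => if hdeg a == N.+1 then w a else phi a) => [a|a ha]; last first.
  by rewrite ha /= e0.
have red c : (hdeg c <= N.+1)%N -> act (diff c)
    (fun a => if hdeg a == N.+1 then w a else phi a) = act (diff c) phi.
  move=> hc; apply: eq_act => b nz; case: eqP => // hb.
  case hc': (hdeg c) => [|i]; first by move: nz; rewrite diff_bottom // ffunE eqxx.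
  by have := in_step_neq0 (in_step_diff cC hc') nz; lia.
move=> ha; rewrite red //; case: eqP => [e|ne]; first by rewrite e; apply: hw.
by apply: hphi; move/eqP: ne ha; lia.
Qed.

(** Uniqueness in the comparison theorem: the homotopy is built degree by
    degree, the part of theta not yet accounted for being a cycle. *)
Lemma null_homotopy C D (theta : C -> {ffun D -> R}) :
  chain C -> chain D -> acyclic D -> chain_map theta ->
  (forall a, hdeg a = 0%N -> exists2 w, in_step 1 w & theta a = bd w) ->
  exists2 s : C -> {ffun D -> R}, forall a, in_step (hdeg a).+1 (s a)
    & forall a, theta a = act (diff a) s + bd (s a).
Proof.
move=> cC cD exD [stheta ctheta] l0.
suff [s hs] : exists s : C -> {ffun D -> R},
    forall a, (hdeg a <= \max_(b : C) hdeg b)%N ->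
      in_step (hdeg a).+1 (s a) /\ theta a = act (diff a) s + bd (s a).
  by exists s => a; have [] := hs a (hdeg_le_max a).
have extend N (s : C -> {ffun D -> R}) :
    (forall a, (hdeg a < N)%N ->
      in_step (hdeg a).+1 (s a) /\ theta a = act (diff a) s + bd (s a)) ->
    (forall a, exists w, hdeg a = N ->
      in_step N.+1 w /\ theta a = act (diff a) s + bd w) ->
    exists s : C -> {ffun D -> R}, forall a, (hdeg a < N.+1)%N ->
      in_step (hdeg a).+1 (s a) /\ theta a = act (diff a) s + bd (s a).
  move=> hs /fin_all_exists [w hw].
  exists (fun a => if hdeg a == N then w a else s a) => a ha.
  rewrite (_ : act (diff a) _ = act (diff a) s); last first.
    apply: eq_act => b nz; case: eqP => // hb.
    case ha': (hdeg a) => [|i]; first by move: nz; rewrite diff_bottom // ffunE eqxx.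
    by have := in_step_neq0 (in_step_diff cC ha') nz; lia.
  case: eqP => [e|ne]; first by rewrite e; apply: hw.
  by apply: hs; move/eqP: ne ha; lia.
have [s hs] : exists s : C -> {ffun D -> R}, forall a,
    (hdeg a < (\max_(b : C) hdeg b).+1)%N ->
      in_step (hdeg a).+1 (s a) /\ theta a = act (diff a) s + bd (s a);
  last by exists s => a; rewrite -ltnS; apply: hs.
elim: (\max_(b : C) _) => [|N [s hs]].
  apply: (extend 0%N (fun _ => 0)) => // a.
  have [ha|/eqP ha] := eqVneq (hdeg a) 0%N; last by exists 0.
  by have [w sw ew] := l0 a ha; exists w => _; rewrite diff_bottom // act0 add0r.
apply: (extend _ _ hs) => a.
have [ha|/eqP ha] := eqVneq (hdeg a) N.+1; last by exists 0.
have sa := in_step_diff cC ha.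
have [||w sw ew] := exD N (theta a - act (diff a) s).
- apply: in_stepB; first by rewrite -ha.
  by apply: (in_step_act sa) => c hc; have [] := hs c; rewrite hc.
- rewrite bdB -ctheta [bd (act _ _)]bdE act_act.
  rewrite (_ : act _ (fun c => act (s c) _) =
      act (diff a) (fun c => theta c + - act (diff c) s)).
    by rewrite act_addr act_oppr -act_act -bdE bd_diff // act0 subr0 subrr.
  apply: eq_act => c nz; have hc := in_step_neq0 sa nz.
  by have [|_ ->] := hs c; rewrite ?hc // addrC addKr bdE.
by exists w => _; split=> //; rewrite -ew addrC subrK.
Qed.

Lemma chain_mapZ C D (q : R) (phi : C -> {ffun D -> R}) : chain_map phi ->
  chain_map (fun a => [ffun b => q * phi a b] : {ffun D -> R}).
Proof.
move=> [sp cp]; split=> [a b hb|a]; first by rewrite ffunE sp ?mulr0.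
apply/ffunP => b; have := congr1 (fun u : {ffun D -> R} => q * u b) (cp a).
rewrite !ffunE !mulr_sumr => e; apply: etrans (etrans e _); apply: eq_bigr => c _.
  by rewrite !ffunE mulrCA.
by rewrite !ffunE mulrA.
Qed.

Lemma chain_mapB C D (phi psi : C -> {ffun D -> R}) :
  chain_map phi -> chain_map psi -> chain_map (fun a => phi a - psi a).
Proof.
move=> [sp cp] [sq cq]; split=> [a|a]; first exact: in_stepB.
by rewrite act_addr act_oppr cp cq bdB.
Qed.

End Comparison.

(** * Koszul complexes of regular sequences *)

Section Koszul.
Variables (k : fieldType) (m n : nat).
Local Notation R := {mpoly k[m]}.
Implicit Types (f : 'I_n -> R) (S T : {set 'I_n}) (d : 'I_n -> nat).
Local Notation chains := {ffun {set 'I_n} -> R}.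

Definition koszul_sign (t : 'I_n) T : R := (-1) ^+ #|[set s in T | (s < t)%N]|.

Lemma koszul_signU1 s t T : s \notin T ->
  koszul_sign t (s |: T) = (-1) ^+ (s < t)%N * koszul_sign t T.
Proof.
move=> sT; rewrite /koszul_sign -exprD; congr (_ ^+ _).
rewrite (_ : [set u in s |: T | (u < t)%N] =
  if (s < t)%N then s |: [set u in T | (u < t)%N] else [set u in T | (u < t)%N]).
  by case: (s < t)%N; rewrite ?cardsU1 ?inE ?(negPf sT).
apply/setP => u; case: ifP => st; rewrite !inE; case: eqP => [->|] //=; by rewrite st ?andbF.
Qed.

(** Summing over the element put back into T, instead of over the sets S
    that cover T, makes the cancellation in the square of the differential and
    the splitting along the last variable visible. *)
Lemma koszul_bdE d f (v : chains) T :
  @bd k m (koszul d f) v T =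
  \sum_(t | t \notin T) v (t |: T) * (koszul_sign t T * f t).
Proof.
rewrite ffunE /= /koszul_diff.
under eq_bigr => S _ do rewrite mulr_sumr.
rewrite (exchange_big_dep predT) //= (bigID (fun t => t \notin T)) /=.
rewrite [X in _ + X]big1 ?addr0 => [|t /negPn tT]; last first.
  rewrite big_pred0 // => S; apply/negbTE; rewrite negb_and -implybE.
  by apply/implyP => _; apply: contraL tT => /eqP ->; rewrite !inE eqxx.
apply: eq_bigr => t tT; rewrite (big_pred1 (t |: T)) => [|S].
  congr (_ * (_ * _)); rewrite -/(koszul_sign t (t |: T)) koszul_signU1 //.
  by rewrite ltnn mul1r.
apply/andP/eqP => [[tS /eqP ->]|->]; first by rewrite setD1K.
by rewrite setU11 setU1K.
Qed.

(** Adding t and then s, or s and then t, gives the same set with opposite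
    signs. *)
Lemma koszul_bd_bd d f (v : chains) :
  @bd k m (koszul d f) (@bd k m (koszul d f) v) = 0.
Proof.
apply/ffunP => T; rewrite koszul_bdE [RHS]ffunE.
pose F t s := v (s |: (t |: T)) * (koszul_sign s T * f s) * (koszul_sign t T * f t).
transitivity (\sum_(t | t \notin T) \sum_(s | (s \notin T) && (s != t))
    (-1) ^+ (t < s)%N * F t s).
  apply: eq_bigr => t tT; rewrite koszul_bdE mulr_suml.
  apply: eq_big => [s|s]; first by rewrite !inE negb_or andbC.
  by move=> _; rewrite koszul_signU1 // /F; ring.
pose G t s := if (t \notin T) && (s \notin T) && (t < s)%N then F t s else 0.
transitivity (\sum_t \sum_s (G s t - G t s)); last first.
  rewrite (eq_bigr (fun t => \sum_s G s t - \sum_s G t s)) => [|t _]; last by rewrite sumrB.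
  by rewrite sumrB exchange_big subrr.
rewrite [LHS]big_mkcond; apply: eq_bigr => t _.
have [tT|tT] := ifPn; last first.
  by rewrite big1 // => s _; rewrite /G (negPf tT) andbF subrr.
rewrite [LHS]big_mkcond; apply: eq_bigr => s _; rewrite /G tT /= andbT.
have [sT|sT] /= := boolP (s \notin T); last by rewrite subrr.
have FC : F t s = F s t by rewrite /F setUCA; ring.
have [lt|lt|/val_inj e] /= := ltngtP t s; last by rewrite e eqxx /= subrr.
  by rewrite -val_eqE /= gtn_eqF // mulN1r sub0r.
by rewrite -val_eqE /= ltn_eqF // FC mul1r subr0.
Qed.

Lemma koszul_chain d f : chain (koszul d f).
Proof.
split=> [S T hST|S U].
  rewrite /= /koszul_diff big1 // => t /andP[tS /eqP eT].
  by case: hST; rewrite /= eT (cardsD1 t S) tS.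
pose v : chains := [ffun T => (T == S)%:R].
transitivity (@bd k m (koszul d f) (@bd k m (koszul d f) v) U); last first.
  by rewrite koszul_bd_bd ffunE.
rewrite [RHS]ffunE; apply: eq_bigr => T _ /=; congr (_ * _).
rewrite ffunE (bigD1 S) //= ffunE eqxx mul1r big1 ?addr0 // => V nV.
by rewrite ffunE (negPf nV) mul0r.
Qed.

Definition initial (j : nat) : {set 'I_n} := [set t : 'I_n | (t < j)%N].
Lemma card_initial j : (j <= n)%N -> #|initial j| = j.
Proof.
move=> jn; rewrite cardsE -sum1_card (eq_bigl (fun s : 'I_n => (s < j)%N)) //.
by rewrite -(big_ord_widen n (fun=> 1%N)) ?sum1_card ?card_ord.
Qed.

(** Chains of the Koszul complex of the first j members of the sequence,
    seen inside the whole complex; this avoids a change of index type in the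
    induction on the length of the sequence. *)
Definition supported (j : nat) (v : chains) : Prop :=
  forall S, ~~ (S \subset initial j) -> v S = 0.

Lemma supported_bd d f j (v : chains) :
  supported j v -> supported j (@bd k m (koszul d f) v).
Proof.
move=> sv T hT; rewrite koszul_bdE big1 // => t _.
rewrite sv ?mul0r //; apply: contra hT; apply: subset_trans.
exact: subsetUr.
Qed.

Definition scalar_chain (c : R) : chains := [ffun S => if S == set0 then c else 0].

Lemma koszul_bd_set0 d f (v : chains) :
  @bd k m (koszul d f) v set0 = \sum_t v [set t] * f t.
Proof.
rewrite koszul_bdE; apply: eq_big => [t|t _]; first by rewrite inE.
rewrite setU0 /koszul_sign (_ : [set _ in _ | _] = set0) ?cards0 ?mul1r //.
by apply/setP => s; rewrite !inE.
Qed.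

Lemma koszul_bd_step1 d f (v : chains) : @in_step k m (koszul d f) 1 v ->
  @bd k m (koszul d f) v = scalar_chain (\sum_t v [set t] * f t).
Proof.
move=> sv; apply/ffunP => S; rewrite [RHS]ffunE.
case: eqP => [->|nS]; first exact: koszul_bd_set0.
have := in_step_bd (koszul_chain d f) sv; apply.
by move=> e; apply: nS; apply: cards0_eq.
Qed.

(** The image of the first Koszul differential is the ideal, also for
    initial segments of the sequence. *)
Lemma span_koszul d f j (c : R) :
  Defs.span (fun t : 'I_n => (t < j)%N) f c <->
  exists v : chains, [/\ supported j v, @in_step k m (koszul d f) 1 v
    & scalar_chain c = @bd k m (koszul d f) v].
Proof.
split=> [[a ->]|[v [sv s1 e]]].
  pose v : chains := [ffun S => \sum_(t : 'I_n | (t < j)%N && (S == [set t])) a t].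
  have s1 : @in_step k m (koszul d f) 1 v.
    move=> S hS; rewrite ffunE big1 // => t /andP[_ /eqP e].
    by case: hS; rewrite e /= cards1.
  exists v; split=> // [S hS|].
    rewrite ffunE big1 // => t /andP[lt /eqP e]; case/negP: hS.
    by rewrite e sub1set inE.
  rewrite koszul_bd_step1 //; congr scalar_chain.
  rewrite big_mkcond; apply: eq_bigr => t _; rewrite ffunE.
  case: ifP => lt.
    rewrite (big_pred1 t) // => s /=; rewrite (inj_eq set1_inj) [s == t]eq_sym.
    by case: eqP => [<-|]; rewrite ?andbF ?lt.
  rewrite big_pred0 ?mul0r // => s /=; rewrite (inj_eq set1_inj).
  by case: eqP => [<-|]; rewrite ?andbF ?lt.
exists (fun t => v [set t]).
have := congr1 (fun u : chains => u set0) e.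
rewrite ffunE eqxx koszul_bd_set0 => ->.
rewrite [RHS]big_mkcond; apply: eq_bigr => t _; case: ifP => // lt.
by rewrite sv ?mul0r // sub1set inE lt.
Qed.

End Koszul.

Section KoszulAcyclic.
Variables (k : fieldType) (m n : nat) (d : 'I_n -> nat) (f : 'I_n -> {mpoly k[m]}).
Local Notation R := {mpoly k[m]}.
Local Notation chains := {ffun {set 'I_n} -> R}.
Local Notation K := (koszul d f).

Lemma initialS (x : 'I_n) : initial n x.+1 = x |: initial n x.
Proof. by apply/setP => t; rewrite !inE ltnS leq_eqVlt. Qed.

Lemma initial_notin (x : 'I_n) (T : {set 'I_n}) : T \subset initial n x -> x \notin T.
Proof. by move/subsetP => h; apply/negP => /h; rewrite inE ltnn. Qed.

Lemma initial_all : initial n n = setT.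
Proof. by apply/setP => t; rewrite !inE ltn_ord. Qed.

(** A chain v of the first x.+1 variables decomposes as u + e_x w, where u
    is its truncation and w its contraction; adjunction w is e_x w up to sign. *)
Definition contraction (x : 'I_n) (v : chains) : chains :=
  [ffun T : {set _} => if T \subset initial n x then v (x |: T) else 0].
Definition truncation (x : 'I_n) (v : chains) : chains :=
  [ffun T : {set _} => if T \subset initial n x then v T else 0].
Definition adjunction (x : 'I_n) (v : chains) : chains :=
  [ffun T : {set _} => if x \in T then v (T :\ x) else 0].

(** No sign occurs, because x is the largest index in sight and the signs only
    count smaller indices. *)
Lemma bd_contraction (x : 'I_n) (v : chains) (T : {set 'I_n}) : supported x.+1 v ->
  T \subset initial n x ->
  @bd k m K v (x |: T) = @bd k m K (contraction x v) T.
Proof.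
move=> sv sT; have xT := initial_notin sT; rewrite !koszul_bdE.
rewrite [RHS](bigD1 x) //= ffunE ifN ?mul0r ?add0r; last first.
  by rewrite subUset sub1set inE ltnn.
apply: eq_big => [t|t]; first by rewrite !inE negb_or andbC.
rewrite !inE negb_or => /andP[ntx tT].
rewrite ffunE subUset sT andbT sub1set inE koszul_signU1 // setUCA.
have [tx|tx|/val_inj e] := ltngtP t x; last by rewrite e eqxx in ntx.
  by rewrite expr0 mul1r.
rewrite sv ?mul0r // initialS 2!subUset !sub1set !inE eqxx (negPf ntx) /=.
by rewrite ltnNge (ltnW tx).
Qed.

Lemma bd_truncation (x : 'I_n) (v : chains) (T : {set 'I_n}) : supported x.+1 v ->
  T \subset initial n x ->
  @bd k m K v T = @bd k m K (truncation x v) T +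
    contraction x v T * ((-1) ^+ #|T| * f x).
Proof.
move=> sv sT; have xT := initial_notin sT; rewrite !koszul_bdE.
rewrite (bigD1 x) //= [in RHS](bigD1 x) //= addrC.
rewrite [truncation _ _ (x |: T)]ffunE ifN; last first.
  by rewrite subUset sub1set inE ltnn.
rewrite mul0r add0r; congr (_ + _); last first.
  rewrite ffunE sT /koszul_sign; congr (_ * ((-1) ^+ #|pred_of_set _| * _)).
  apply/setP => s; rewrite inE; case sT': (s \in T) => //=.
  by have := subsetP sT _ sT'; rewrite inE.
apply: eq_bigr => t /andP[tT ntx]; rewrite ffunE; case: ifP => // /negbT.
rewrite subUset sT andbT sub1set inE => tx.
by rewrite sv // initialS subUset sub1set !inE (negPf ntx) (negPf tx).
Qed.

Lemma adjunctionK (x : 'I_n) (w : chains) : supported x w ->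
  contraction x (adjunction x w) = w.
Proof.
move=> sw; apply/ffunP => S; rewrite !ffunE setU11; case: ifP => [sS|/negbT/sw ->//].
by rewrite setU1K // initial_notin.
Qed.

Hypothesis f_regular : regular_sequence f.

(** Induction on the length of the sequence.  For a cycle u + e_x w, the
    chain w is a cycle and f x * w is a boundary.  In positive degree w is a
    boundary by induction; in degree 0 it is a scalar, and it is a boundary
    because f x is regular modulo the previous members.  If w = bd w', then
    subtracting the boundary of e_x w' leaves a cycle that does not involve
    x. *)
Lemma koszul_prefix_acyclic j : (j <= n)%N ->
  forall i (v : chains), supported j v -> @in_step k m K i.+1 v ->
    @bd k m K v = 0 ->
    exists w : chains, [/\ supported j w, @in_step k m K i.+2 w
      & v = @bd k m K w].
Proof.
elim: j => [_|j IH jn] i v sv iv bv.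
  exists 0; split=> [S _|S _|]; rewrite ?ffunE // bd0.
  apply/ffunP => S; rewrite [RHS]ffunE; have [S0|nS0] := eqVneq S set0.
    by apply: iv; rewrite S0 /= cards0.
  apply: sv; apply: contra nS0 => sS; rewrite -subset0.
  by apply: subset_trans sS _; apply/subsetP => t; rewrite inE.
pose x := Ordinal jn; have {}IH := IH (ltnW jn).
have sc : supported j (contraction x v) by move=> S hS; rewrite ffunE ifN.
have ic : @in_step k m K i (contraction x v).
  move=> S hS; rewrite ffunE; case: ifP => // sS; apply: iv => /= e.
  by apply: hS; move: e; rewrite cardsU1 (@initial_notin x) // => -[].
have bc : @bd k m K (contraction x v) = 0.
  apply/ffunP => T; case sT: (T \subset initial n j).
    by rewrite -(@bd_contraction x) // bv !ffunE.
  by rewrite (supported_bd d f sc) ?sT // ffunE.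
have bt (T : {set _}) : T \subset initial n j -> @bd k m K (truncation x v) T =
    - (contraction x v T * ((-1) ^+ #|T| * f x)).
  move=> sT; apply/eqP; rewrite -addr_eq0 -(@bd_truncation x) //.
  by rewrite bv ffunE.
have [w [sw iw ew]] : exists w : chains, [/\ supported j w,
    @in_step k m K i.+1 w & contraction x v = @bd k m K w].
  case: i ic iv => [|i] ic iv; last exact: IH.
  (* In degree 0 acyclicity is not available and regularity of f x is used. *)
  have -> : contraction x v = scalar_chain n (contraction x v set0).
    apply/ffunP => S; rewrite [RHS]ffunE; case: eqP => [->//|nS].
    by apply: ic => /cards0_eq.
  apply/span_koszul; apply: (proj1 f_regular x).
  apply/(span_koszul d); exists (- truncation x v); split.
  - by move=> S hS; rewrite !ffunE ifN ?oppr0.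
  - apply: in_stepN => S hS; rewrite ffunE; case: ifP => // sS.
    exact: iv.
  rewrite bdN; apply/ffunP => T; rewrite ffunE [RHS]ffunE.
  case: eqP => [->|nT].
    by rewrite bt ?sub0set // cards0 expr0 mul1r opprK.
  case sT: (T \subset initial n j).
    by rewrite bt // (ic T) ?mul0r ?oppr0 // => /cards0_eq.
  rewrite (@supported_bd k m n d f j) ?sT ?oppr0 // => S hS.
  by rewrite ffunE ifN.
pose u := v - @bd k m K (adjunction x w).
have sa : supported j.+1 (adjunction x w).
  move=> S hS; rewrite ffunE; case: ifP => // xS; apply: sw.
  apply: contra hS => sS; rewrite -(setD1K xS) (initialS x).
  exact: setUS.
have ia : @in_step k m K i.+2 (adjunction x w).
  move=> S hS; rewrite ffunE; case: ifP => // xS; apply: iw => /= e.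
  by apply: hS; rewrite /= (cardsD1 x) xS e.
have [|||w' [sw' iw' ew']] := IH i u.
- move=> S hS; rewrite /u ffunE [X in _ + X]ffunE.
  case sS: (S \subset initial n j.+1); last first.
    by rewrite sv ?sS // (supported_bd d f sa) ?sS // subr0.
  have xS : x \in S.
    apply: contraNT hS => xS; move: sS; rewrite (initialS x) => sS.
    by apply/subsetP => t tS; move/subsetP/(_ t tS): sS xS; rewrite !inE;
      case: eqP tS => [->->|].
  have sT : S :\ x \subset initial n j.
    by rewrite subDset -(initialS x).
  rewrite -(setD1K xS) (@bd_contraction x) // adjunctionK // -ew ffunE sT.
  by rewrite subrr.
- apply: in_stepB => //; exact: in_step_bd (koszul_chain d f) ia.
- by rewrite bdB bv sub0r koszul_bd_bd oppr0.
exists (adjunction x w + w'); split.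
- move=> S hS; rewrite ffunE sa // add0r; apply: sw'.
  apply: contra hS => sS; rewrite (initialS x); exact: subset_trans sS (subsetUr _ _).
- exact: in_stepD.
- by rewrite bdD -ew' addrC subrK.
Qed.

End KoszulAcyclic.

Section KoszulResolution.
Variables (k : fieldType) (m n : nat) (d : 'I_n -> nat) (f : 'I_n -> {mpoly k[m]}).
Local Notation R := {mpoly k[m]}.

Lemma koszul_acyclic : regular_sequence f -> acyclic (koszul d f).
Proof.
move=> rf i v iv bv; have [|w [_ iw ew]] := koszul_prefix_acyclic rf (leqnn n) _ iv bv.
  by move=> S; rewrite initial_all subsetT.
by exists w.
Qed.

Lemma ideal_koszul c : ideal f c <->
  exists2 v, @in_step k m (koszul d f) 1 v & scalar_chain n c = bd v.
Proof.
have e : ideal f c <-> Defs.span (fun t : 'I_n => (t < n)%N) f c.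
  by split=> -[a ->]; exists a; apply: eq_bigl => t; rewrite ltn_ord.
rewrite e (span_koszul d); split=> [[v [_ iv ev]]|[v iv ev]]; first by exists v.
by exists v; split=> // S; rewrite initial_all subsetT.
Qed.

End KoszulResolution.

(** * Self-duality of the Koszul complex *)

Section Ideals.
Variables (k : fieldType) (m n : nat).
Local Notation R := {mpoly k[m]}.
Implicit Types (f g : 'I_n -> R) (P : pred 'I_n).

Lemma span_mem f P i : P i -> Defs.span P f (f i).
Proof.
move=> Pi; exists (fun j => (j == i)%:R); rewrite (bigD1 i) //= eqxx mul1r.
by rewrite big1 ?addr0 // => j /andP[_ /negPf ->]; rewrite mul0r.
Qed.

Lemma spanD f P p q : Defs.span P f p -> Defs.span P f q -> Defs.span P f (p + q).
Proof.
move=> [a ->] [b ->]; exists (fun i => a i + b i).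
by rewrite -big_split; apply: eq_bigr => i _; rewrite mulrDl.
Qed.

Lemma spanM f P p q : Defs.span P f q -> Defs.span P f (p * q).
Proof.
move=> [a ->]; exists (fun i => p * a i).
by rewrite mulr_sumr; apply: eq_bigr => i _; rewrite mulrA.
Qed.

Lemma span0 f P : Defs.span P f 0.
Proof. by exists (fun=> 0); rewrite big1 // => i _; rewrite mul0r. Qed.

Lemma spanN f P p : Defs.span P f p -> Defs.span P f (- p).
Proof. by rewrite -mulN1r; apply: spanM. Qed.

Lemma span_sum f P (I : Type) (r : seq I) (Q : pred I) (F : I -> R) :
  (forall i, Q i -> Defs.span P f (F i)) -> Defs.span P f (\sum_(i <- r | Q i) F i).
Proof.
move=> h; elim/big_ind: _ => //; [exact: span0 | move=> ? ?; exact: spanD].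
Qed.

Lemma span_sub f g P Q : (forall i, P i -> Defs.span Q g (f i)) ->
  forall p, Defs.span P f p -> Defs.span Q g p.
Proof. by move=> h p [a ->]; apply: span_sum => i Pi; apply: spanM; apply: h. Qed.

End Ideals.

Section Duality.
Variables (k : fieldType) (m n : nat).
Local Notation R := {mpoly k[m]}.
Implicit Types (f g : 'I_n -> R) (d e : 'I_n -> nat).

(** The sequence whose Koszul complex is the dual of the one of f, when the
    dual basis element of e_S is indexed by the complement of S. *)
Definition alternate f (t : 'I_n) : R := (-1) ^+ t * f t.

Lemma span_alternate P f p : Defs.span P (alternate f) p <-> Defs.span P f p.
Proof.
split; apply: span_sub => t Pt; first by apply: spanM; apply: span_mem.
rewrite -[f t](signrMK t) -/(alternate f t); by apply: spanM; apply: span_mem.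
Qed.

Lemma alternate_regular f : regular_sequence f -> regular_sequence (alternate f).
Proof.
move=> [rf pf]; split; last by move/span_alternate.
move=> i p /span_alternate h; apply/span_alternate; apply: rf.
rewrite -[p * f i](signrMK i); apply: spanM; rewrite mulrCA; exact: h.
Qed.

(** Among the t indices smaller than t, those in A and those in the
    complement of B are counted by the two signs, whence the factor
    (-1) ^+ t. *)
Lemma koszul_diff_compl f (A B : {set 'I_n}) :
  koszul_diff f (~: B) (~: A) = koszul_diff (alternate f) A B.
Proof.
apply: eq_big => [t|t /andP[tB /eqP eA]].
  rewrite !inE; apply/andP/andP => -[h1 /eqP h2]; split; rewrite ?h2 ?inE ?eqxx //.
  - by move/setP/(_ t): h2; rewrite !inE eqxx => /negbFE.
  - apply/eqP/setP => s; move/setP/(_ s): h2; rewrite !inE.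
    by case: eqP => [->|] /=; [rewrite (negPf h1)|move=> _ /(can_inj negbK) ->].
  - by apply/eqP/setP => s; rewrite !inE; case: eqP => [->|] //=; rewrite h1.
rewrite /alternate mulrA -exprD; congr (_ * _).
pose X := initial n t; have cX : #|X| = t by rewrite card_initial // ltnW.
have eq_B (s : 'I_n) : (s < t)%N -> (s \in ~: B) = (s \notin A).
  move=> st; move/setP/(_ s): eA; rewrite !inE.
  by case: eqP st => [->|_ _ /= ->//]; rewrite ltnn.
have eC : (#|X :&: A| + #|X :\: A|)%N = t by rewrite cardsID.
rewrite (_ : [set s in ~: B | _] = X :\: A); last first.
  by apply/setP => s; rewrite !inE; case: ltnP => st; rewrite ?andbF // -(eq_B s st) inE.
rewrite (_ : [set s in A | _] = X :&: A); last first.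
  by apply/setP => s; rewrite !inE andbC.
by rewrite -[in RHS]eC -[RHS]signr_odd !oddD addKb signr_odd.
Qed.

End Duality.

(** * Linked ideals *)

Section Linkage.
Variables (k : fieldType) (m n : nat).
Local Notation R := {mpoly k[m]}.
Implicit Types (d e : 'I_n -> nat).

(** The transposed map between dual Koszul complexes, in the indexing by
    complements. *)
Definition dualize (phi : {set 'I_n} -> {ffun {set 'I_n} -> R}) (S : {set 'I_n}) :
  {ffun {set 'I_n} -> R} := [ffun T : {set 'I_n} => phi (~: T) (~: S)].

Lemma dual_chain_map d d' e e' (f f' g g' : 'I_n -> R)
    (phi : {set 'I_n} -> {ffun {set 'I_n} -> R}) :
  (forall A B, koszul_diff f (~: B) (~: A) = koszul_diff f' A B) ->
  (forall A B, koszul_diff g (~: B) (~: A) = koszul_diff g' A B) ->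
  @chain_map k m (koszul e g) (koszul d f) phi ->
  @chain_map k m (koszul d' f') (koszul e' g') (dualize phi).
Proof.
move=> hf hg [sp cp]; split=> [S T /= hT|S].
  rewrite ffunE; apply: sp => /= ec; apply: hT.
  by have := cardsC S; have := cardsC T; rewrite ec => <- /addIn.
apply/ffunP => U; have := congr1 (fun u : {ffun {set 'I_n} -> R} => u (~: S)) (cp (~: U)).
rewrite !ffunE => e1.
rewrite (reindex_inj (@setC_inj _)) [RHS](reindex_inj (@setC_inj _)) /= in e1.
rewrite -[LHS](_ : \sum_T phi (~: U) (~: T) * koszul_diff f (~: T) (~: S) = _).
  rewrite -e1; apply: eq_bigr => T _; by rewrite !ffunE /= hg mulrC.
by apply: eq_bigr => T _; rewrite !ffunE /= hf mulrC.
Qed.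

Lemma koszul_diff_set1 f (i : 'I_n) : koszul_diff f [set i] set0 = f i :> R.
Proof.
rewrite /koszul_diff (big_pred1 i) => [|t].
  rewrite (_ : [set _ in _ | _] = set0) ?cards0 ?mul1r //.
  apply/setP => s; rewrite !inE; have [->|//] := eqVneq s i.
  by rewrite ltnn.
rewrite /= inE; have [->|//] := eqVneq t i.
by apply/eqP/setP => s; rewrite !inE; case: (s == i).
Qed.

Lemma act_diff_set1 d f (i : 'I_n) (psi : {set 'I_n} -> {ffun {set 'I_n} -> R}) c :
  psi set0 = scalar_chain n c ->
  act (@diff k m (koszul d f) [set i]) psi = scalar_chain n (f i * c).
Proof.
move=> p0; apply/ffunP => S; rewrite ffunE (bigD1 set0) //= big1 ?addr0.
  rewrite p0 !ffunE /= koszul_diff_set1; by case: eqP; rewrite ?mulr0.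
move=> T nT; rewrite ffunE (proj1 (koszul_chain d f)) ?mul0r //= cards1.
by case=> /esym /cards0_eq T0; rewrite T0 eqxx in nT.
Qed.

Lemma koszul_diff_setT_ideal f (s : {set 'I_n} -> R) :
  ideal f (\sum_S koszul_diff f setT S * s S).
Proof.
apply: span_sum => S _; rewrite mulr_suml; apply: span_sum => t _.
by rewrite mulrAC; apply: spanM; apply: span_mem.
Qed.

Lemma koszul_diff_setT_r f (S : {set 'I_n}) : koszul_diff f S setT = 0 :> R.
Proof.
rewrite /koszul_diff big_pred0 // => t; apply/negbTE; rewrite negb_and.
by apply/orP; right; apply/eqP => /setP/(_ t); rewrite !inE eqxx.
Qed.

Lemma bd_koszul_setT d f (v : {ffun {set 'I_n} -> R}) : @bd k m (koszul d f) v setT = 0.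
Proof. by rewrite ffunE big1 // => S _; rewrite /= koszul_diff_setT_r mulr0. Qed.

Lemma row_set0 d d' (f f' : 'I_n -> R) (psi : {set 'I_n} -> {ffun {set 'I_n} -> R}) :
  @chain_map k m (koszul d f) (koszul d' f') psi ->
  psi set0 = scalar_chain n (psi set0 set0).
Proof.
move=> [sp _]; apply/ffunP => S; rewrite [RHS]ffunE; case: eqP => [->//|nS].
by apply: sp => /=; rewrite cards0 => /cards0_eq.
Qed.

Lemma row_setT d d' (f f' : 'I_n -> R) (psi : {set 'I_n} -> {ffun {set 'I_n} -> R}) S :
  @chain_map k m (koszul d f) (koszul d' f') psi -> S != setT ->
  psi S setT = 0.
Proof.
move=> [sp _] nS; apply: sp => /= ec; case/negP: nS.
by rewrite eqEcard subsetT ec leqnn.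
Qed.

(** A chain map that is zero in homology in degree 0 is null-homotopic.
    At the top set the homotopy only contributes through the top differential,
    whose entries lie in the ideal. *)
Lemma top_coef_ideal d d' (f f' : 'I_n -> R)
    (theta : {set 'I_n} -> {ffun {set 'I_n} -> R}) :
  regular_sequence f' ->
  @chain_map k m (koszul d f) (koszul d' f') theta ->
  ideal f' (theta set0 set0) -> ideal f (theta setT setT).
Proof.
move=> rf' ct /(ideal_koszul d') [w sw ew].
have [|s ss es] := null_homotopy (koszul_chain d f) (koszul_chain d' f')
    (koszul_acyclic rf') ct.
  move=> a /cards0_eq ->; exists w => //; rewrite -ew; exact: row_set0 ct.
have -> : theta setT setT = \sum_S koszul_diff f setT S * s S setT.
  rewrite es ffunE bd_koszul_setT addr0 ffunE.
  by apply: eq_bigr => S _; rewrite ffunE.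
exact: koszul_diff_setT_ideal.
Qed.

Variables (d e : 'I_n -> nat) (f g : 'I_n -> R).
Hypotheses (f_regular : regular_sequence f) (g_regular : regular_sequence g).
Variable phi : {set 'I_n} -> {ffun {set 'I_n} -> R}.
Hypothesis phi_chain : @chain_map k m (koszul e g) (koszul d f) phi.
Hypothesis phi0 : phi set0 set0 = 1.
Let delta := phi setT setT.

Lemma dual_phi_chain :
  @chain_map k m (koszul d (alternate f)) (koszul e (alternate g)) (dualize phi).
Proof.
by apply: dual_chain_map phi_chain => A B; rewrite koszul_diff_compl.
Qed.

Lemma dual_phi_set0 : dualize phi set0 set0 = delta.
Proof. by rewrite ffunE setC0. Qed.

(** If q * delta vanishes in R/K, then q times the dual of phi lifts the zero
    map R/I -> R/K; its top coefficient is q times the degree 0 coefficient of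
    phi, which is 1. *)
Lemma link_injective q : ideal g (q * delta) -> ideal f q.
Proof.
move/span_alternate => h; apply/span_alternate.
have ct := chain_mapZ q dual_phi_chain.
have := top_coef_ideal (alternate_regular g_regular) ct.
by rewrite !ffunE setC0 setCT phi0 mulr1; apply.
Qed.

(** The dual of phi is a chain map, so that it induces on H_0 a map from R/I
    to R/K, namely multiplication by delta. *)
Lemma mul_delta_mem i : ideal g (f i * delta).
Proof.
rewrite -[f i](signrMK i) -/(alternate f i) -mulrA; apply: spanM.
apply/span_alternate/(ideal_koszul e).
have [sp cp] := dual_phi_chain.
exists (dualize phi [set i] : {ffun {set 'I_n} -> R}).
  by have := sp [set i]; rewrite /= cards1.
rewrite -cp; apply/esym/act_diff_set1.
by rewrite (row_set0 dual_phi_chain) dual_phi_set0.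
Qed.

(** For p in K : I, multiplication by p is a map R/I -> R/K.  It lifts to a
    chain map psi, whose dual lifts multiplication by q := psi setT setT from
    R/K to R/I, as does q times phi.  The two lifts have top coefficients p and
    q * delta, and they are homotopic. *)
Lemma link_colon p : colon (ideal g) (ideal f) p <->
  exists q, ideal g (p - q * delta).
Proof.
split; last first.
  move=> [q h] r [a ->]; rewrite -[p](subrK (q * delta)) mulrDl.
  apply: spanD; first by rewrite mulrC; apply: spanM.
  rewrite mulr_sumr; apply: span_sum => i _.
  rewrite (_ : _ * _ = q * a i * (f i * delta)); last by ring.
  exact/spanM/mul_delta_mem.
move=> hp.
pose f' := alternate f; pose g' := alternate g.
have [||psi cpsi psi0] := @lift_chain_map k m (koszul d f') (koszul e g')
   (fun=> scalar_chain n p) (koszul_chain d f') (koszul_chain e g')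
   (koszul_acyclic (alternate_regular g_regular)).
- move=> a _ S hS; rewrite ffunE; case: eqP => // S0; case: hS.
  by rewrite S0 /= cards0.
- move=> a ha; have /eqP/cards1P[i ai] : #|a : {set 'I_n}| = 1%N := ha.
  suff [w sw ew] : exists2 w, @in_step k m (koszul e g') 1 w &
      scalar_chain n (f' i * p) = bd w.
    by exists w => //; rewrite -ew ai; apply: act_diff_set1.
  apply/(ideal_koszul e); apply/span_alternate; rewrite mulrC; apply: hp.
  by apply/spanM/span_mem.
have cs : @chain_map k m (koszul e g) (koszul d f) (dualize psi).
  by apply: dual_chain_map cpsi => A B; rewrite -koszul_diff_compl !setCK.
exists (psi setT setT).
have ps0 : psi set0 = scalar_chain n p by apply: psi0; apply: cards0.
have := top_coef_ideal f_regular (chain_mapB cs (chain_mapZ (psi setT setT) phi_chain)).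
rewrite !ffunE setC0 setCT phi0 mulr1 subrr ps0 ffunE eqxx.
by apply; exact: span0.
Qed.

End Linkage.

(** * Homogeneous components and minimal resolutions *)

Section HomogeneousParts.
Variables (k : fieldType) (m : nat).
Local Notation R := {mpoly k[m]}.
Implicit Types (p q : R) (z w : int).

(** Degrees are integers because differences of shifts may be negative. *)
Definition hpart z p : R :=
  match z with Posz t => pihomog mdeg t p | Negz _ => 0 end.

Lemma homog_of_deg_nat (t : nat) p : homog_of_deg t%:Z p <-> p \is t.-homog.
Proof.
split=> [h|/dhomogP h u /h ->//]; apply/dhomogP => u /h [] //.
Qed.

Lemma homog_of_deg_neg (t : nat) p : homog_of_deg (Negz t) p -> p = 0.
Proof.
rewrite /homog_of_deg => h; apply: msuppnil0.
by case: (msupp p) h => // u s /(_ u (mem_head _ _)).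
Qed.

Lemma homog_of_deg0 z : homog_of_deg z (0 : R).
Proof. by move=> u; rewrite msupp0. Qed.

Lemma homog_of_degD z p q : homog_of_deg z p -> homog_of_deg z q ->
  homog_of_deg z (p + q).
Proof. by move=> hp hq u /msuppD_le; rewrite mem_cat => /orP[/hp|/hq]. Qed.

Lemma homog_of_degN z p : homog_of_deg z p -> homog_of_deg z (- p).
Proof. by move=> hp u; rewrite (perm_mem (msuppN p)) => /hp. Qed.

Lemma homog_of_degM z w p q : homog_of_deg z p -> homog_of_deg w q ->
  homog_of_deg (z + w) (p * q).
Proof.
move=> hp hq u /msuppM_le /allpairsP [[u1 u2] /= [/hp <- /hq <- ->]].
by rewrite mdegD PoszD.
Qed.

Lemma homog_of_deg_sum z (I : Type) (r : seq I) (P : pred I) (F : I -> R) :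
  (forall i, P i -> homog_of_deg z (F i)) -> homog_of_deg z (\sum_(i <- r | P i) F i).
Proof.
move=> h; elim/big_ind: _ => //; [exact: homog_of_deg0 | move=> ? ?; exact: homog_of_degD].
Qed.

Lemma homog_of_deg1 : homog_of_deg 0 (1 : R).
Proof. by apply/(homog_of_deg_nat 0); apply: dhomog1. Qed.

Lemma homog_of_deg_sign i : homog_of_deg 0 ((-1) ^+ i : R).
Proof.
rewrite -signr_odd; case: (odd i); rewrite ?expr0 ?expr1; [apply: homog_of_degN|];
  exact: homog_of_deg1.
Qed.

Lemma hpartD z p q : hpart z (p + q) = hpart z p + hpart z q.
Proof. by case: z => t /=; rewrite ?addr0 // pihomogD. Qed.

Lemma hpart0 z : hpart z 0 = 0.
Proof. by case: z => t //=; rewrite pihomog0. Qed.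

Lemma hpartN z p : hpart z (- p) = - hpart z p.
Proof. by case: z => t /=; rewrite ?oppr0 // pihomogN. Qed.

Lemma hpart_sum z (I : Type) (r : seq I) (P : pred I) (F : I -> R) :
  hpart z (\sum_(i <- r | P i) F i) = \sum_(i <- r | P i) hpart z (F i).
Proof.
elim/big_rec2: _ => [|i x y _ <-]; [exact: hpart0 | exact: hpartD].
Qed.

Lemma hpart_homog z p : homog_of_deg z (hpart z p).
Proof.
case: z => t /=; [apply/homog_of_deg_nat; exact: pihomogP | exact: homog_of_deg0].
Qed.

Lemma hpart_id z p : homog_of_deg z p -> hpart z p = p.
Proof.
by case: z => t; [move/homog_of_deg_nat/pihomog_dE | move/homog_of_deg_neg].
Qed.

Lemma hpart_neq z w p : homog_of_deg z p -> z != w -> hpart w p = 0.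
Proof.
case: w => [t|t] //; case: z => [s|s]; last first.
  by move/homog_of_deg_neg => -> _; rewrite hpart0.
move/homog_of_deg_nat => hp ne; apply: pihomog_ne0 hp.
by apply: contra ne => /eqP ->.
Qed.

Lemma hpart_partition p : exists N, p = \sum_(t < N) hpart (t : nat)%:Z p.
Proof. by exists (msize p); apply: pihomog_partitionE. Qed.

Lemma hpartMl z w p q : homog_of_deg z q -> hpart (z + w) (q * p) = q * hpart w p.
Proof.
move=> hq; have [N ep] := hpart_partition p.
rewrite {1}ep mulr_sumr hpart_sum {2}ep hpart_sum mulr_sumr.
apply: eq_bigr => t _; have ht := @hpart_homog (t : nat)%:Z p.
have [<-|ne] := eqVneq (t : nat)%:Z w.
  by rewrite (hpart_id ht) hpart_id //; apply: homog_of_degM.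
rewrite (hpart_neq ht ne) mulr0; apply: hpart_neq (homog_of_degM hq ht) _.
by rewrite (inj_eq (addrI z)).
Qed.

Lemma hpartMr z w p q : homog_of_deg z q -> hpart (w + z) (p * q) = hpart w p * q.
Proof. by move=> hq; rewrite addrC mulrC hpartMl // mulrC. Qed.

Lemma homog_of_deg_const z p : homog_of_deg z p -> p@_0%MM != 0 -> z = 0.
Proof. by move=> hp; rewrite -mcoeff_msupp => /hp <-; rewrite mdeg0. Qed.

Definition ideal_like (J : R -> Prop) :=
  [/\ J 0, (forall p q, J p -> J q -> J (p + q)) & (forall p q, J q -> J (p * q))].

Definition graded_ideal (J : R -> Prop) :=
  ideal_like J /\ forall z p, J p -> J (hpart z p).

Lemma ideal_like_sum J (I : Type) (r : seq I) (P : pred I) (F : I -> R) :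
  ideal_like J -> (forall i, P i -> J (F i)) -> J (\sum_(i <- r | P i) F i).
Proof. by move=> [J0 JD _] h; elim/big_ind: _. Qed.

Lemma ideal_likeN J p : ideal_like J -> J p -> J (- p).
Proof. by move=> [_ _ JM]; rewrite -mulN1r; apply: JM. Qed.

Lemma ideal_likeB J p q : ideal_like J -> J p -> J q -> J (p - q).
Proof. by move=> iJ hp hq; case: (iJ) => _ JD _; apply: JD (ideal_likeN iJ hq). Qed.

Lemma span_graded n (d : 'I_n -> nat) (f : 'I_n -> R) P :
  (forall i, f i \is (d i).-homog) -> graded_ideal (Defs.span P f).
Proof.
move=> hf; split.
  split; first exact: span0.
    by move=> ? ?; apply: spanD.
  by move=> ? ?; apply: spanM.
move=> z p [a ->]; rewrite hpart_sum; apply: span_sum => i Pi.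
have -> : z = (z - (d i)%:Z) + (d i)%:Z by rewrite subrK.
by rewrite hpartMr; [apply/spanM/span_mem | apply/homog_of_deg_nat].
Qed.

Lemma colon_graded n (d e : 'I_n -> nat) (f g : 'I_n -> R) :
  (forall i, f i \is (d i).-homog) -> (forall i, g i \is (e i).-homog) ->
  graded_ideal (colon (ideal g) (ideal f)).
Proof.
move=> hf hg; split; first split.
- by move=> q _; rewrite mul0r; apply: span0.
- by move=> p q hp hq r hr; rewrite mulrDl; apply: spanD; [apply: hp | apply: hq].
- by move=> p q hq r hr; rewrite -mulrA; apply: spanM; apply: hq.
move=> z p hp q [a ->]; rewrite mulr_sumr; apply: span_sum => i _.
rewrite mulrCA; apply: spanM; rewrite -(@hpartMr (d i)%:Z).
  by apply: (proj2 (span_graded predT hg)); apply: hp; apply: span_mem.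
exact/homog_of_deg_nat.
Qed.

End HomogeneousParts.

Section MinimalResolutions.
Variables (k : fieldType) (m : nat).
Local Notation R := {mpoly k[m]}.
Implicit Types C D : graded_free k m.

(** The component of degree 0 of a map of graded free modules; it makes the
    ungraded comparison theorem sufficient for graded complexes. *)
Definition homogenize C D (phi : C -> {ffun D -> R}) (a : C) : {ffun D -> R} :=
  [ffun b => hpart (gshift a - gshift b) (phi a b)].

Definition graded_diff C :=
  forall a b : C, homog_of_deg (gshift a - gshift b) (gdiff a b).

Lemma homogenize_chain_map C D (phi : C -> {ffun D -> R}) :
  graded_diff C -> graded_diff D -> chain_map phi -> chain_map (homogenize phi).
Proof.
move=> hC hD [sp cp]; split=> [a b hb|a]; first by rewrite ffunE sp ?hpart0.
apply/ffunP => b; have := congr1 (fun u : {ffun D -> R} =>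
  hpart (gshift a - gshift b) (u b)) (cp a).
rewrite !ffunE !hpart_sum => e; apply: etrans (etrans e _); apply: eq_bigr => c _.
  rewrite !ffunE -(hpartMl _ _ (hC a c)); congr (hpart _ _); ring.
rewrite !ffunE -(hpartMr _ _ (hD c b)); congr (hpart _ _); ring.
Qed.

Definition augment C (eps : C -> R) (v : {ffun C -> R}) : R := \sum_b v b * eps b.

Definition augmentation (J : R -> Prop) C (eps : C -> R) : Prop :=
  [/\ forall b : C, hdeg b = 0%N -> homog_of_deg (gshift b) (eps b),
      exists2 v : {ffun C -> R}, in_step 0 v & J (1 - augment eps v)
    & forall v : {ffun C -> R}, in_step 0 v ->
        (J (augment eps v) <-> exists2 w : {ffun C -> R}, in_step 1 w & v = bd w)].

Lemma augment_act C D (eps : D -> R) v (phi : C -> {ffun D -> R}) :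
  augment eps (act v phi) = \sum_c v c * augment eps (phi c).
Proof.
rewrite /augment; under eq_bigr => b _ do rewrite ffunE mulr_suml.
rewrite exchange_big; apply: eq_bigr => c _; rewrite mulr_sumr.
by apply: eq_bigr => b _; rewrite mulrA.
Qed.

Lemma augmentB C (eps : C -> R) v w :
  augment eps (v - w) = augment eps v - augment eps w.
Proof.
by rewrite /augment -sumrB; apply: eq_bigr => b _; rewrite !ffunE mulrBl.
Qed.

Definition lifts_id (J : R -> Prop) C D (epsC : C -> R) (epsD : D -> R)
    (phi : C -> {ffun D -> R}) : Prop :=
  forall a, hdeg a = 0%N -> J (augment epsD (phi a) - epsC a).

Definition basis_vector C (a : C) : {ffun C -> R} := [ffun b => (b == a)%:R].

Lemma in_step_basis C (a : C) : in_step (hdeg a) (basis_vector a).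
Proof. by move=> b hb; rewrite ffunE; case: eqP hb => [->|]. Qed.

Lemma act_basis C (B : finType) (a : C) (phi : C -> {ffun B -> R}) :
  act (basis_vector a) phi = phi a.
Proof.
apply/ffunP => b; rewrite ffunE (bigD1 a) //= ffunE eqxx mul1r big1 ?addr0 //.
by move=> c /negPf nc; rewrite ffunE nc mul0r.
Qed.

Lemma augment_basis C (eps : C -> R) (a : C) : augment eps (basis_vector a) = eps a.
Proof.
rewrite /augment (bigD1 a) //= ffunE eqxx mul1r big1 ?addr0 //.
by move=> c /negPf nc; rewrite ffunE nc mul0r.
Qed.

(** The degree 0 generators need not map to 1 under the augmentations, so
    that the lift in degree 0 multiplies a preimage of 1 by the augmentation. *)
Lemma resolution_lift J C D (epsC : C -> R) (epsD : D -> R) :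
  ideal_like J -> chain C -> chain D -> acyclic D ->
  augmentation J epsC -> augmentation J epsD ->
  exists2 phi : C -> {ffun D -> R}, chain_map phi & lifts_id J epsC epsD phi.
Proof.
move=> iJ cC cD exD [_ _ aC] [_ [v sv Jv] aD].
have [J0 JD JM] := iJ.
(* The augmentation of v is 1 modulo J. *)
pose phi0 (a : C) : {ffun D -> R} := [ffun b => epsC a * v b].
have s0 a : in_step 0 (phi0 a) by move=> b hb; rewrite ffunE sv ?mulr0.
have l0 a : J (augment epsD (phi0 a) - epsC a).
  rewrite (_ : _ - _ = (- epsC a) * (1 - augment epsD v)); first exact: JM.
  rewrite mulrBr mulr1 mulNr opprK addrC; congr (_ + _).
  by rewrite /augment mulr_sumr; apply: eq_bigr => b _; rewrite ffunE mulrA.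
have [|a ha|phi cphi ephi] := @lift_chain_map k m C D phi0 cC cD exD.
- by move=> a _; apply: s0.
- apply/aD; first by apply: (in_step_act (in_step_diff cC ha)).
  rewrite augment_act -[X in J X](subrK (augment epsC (diff a))).
  apply: JD.
    rewrite /augment -sumrB; apply: ideal_like_sum => // c _.
    by rewrite -mulrBr; apply: JM; apply: l0.
  apply/aC; first exact: in_step_diff.
  exists (basis_vector a); first by rewrite -ha; apply: in_step_basis.
  by rewrite bdE act_basis.
by exists phi => // a ha; rewrite ephi.
Qed.

Lemma lifts_id_homogenize J C D (epsC : C -> R) (epsD : D -> R) phi :
  graded_ideal J -> augmentation J epsC -> augmentation J epsD ->
  chain_map phi -> lifts_id J epsC epsD phi -> lifts_id J epsC epsD (homogenize phi).
Proof.
move=> [_ hJ] [hC _ _] [hD _ _] [sp _] l a ha.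
have := hJ (gshift a) _ (l a ha); rewrite hpartD hpartN (hpart_id (hC a ha)).
congr (J (_ - _)); rewrite /augment hpart_sum; apply: eq_bigr => b _.
have [hb|/eqP hb] := eqVneq (hdeg b) 0%N; last first.
  by rewrite ffunE sp ?ha // hpart0 !mul0r hpart0.
by rewrite ffunE -(hpartMr _ _ (hD b hb)) subrK.
Qed.

(** The composite of lifts from C to D and back differs from the identity by
    a homotopy, all of whose terms involve entries of the differential of C.
    Hence the constant term of its diagonal entry at a is 1, and the lift from
    C to D has an entry at (a, b) with a nonzero constant term.  As this
    lift is homogeneous of degree 0, a and b have the same shift. *)
Theorem minimal_resolution_shift J C D :
  graded_ideal J -> is_minimal_free_resolution J C -> is_free_resolution J D ->
  forall a : C, exists2 b : D, hdeg b = hdeg a & gshift b = gshift a.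
Proof.
move=> gJ [[[dC hC ddC] exC [epsC aC]] mC] [[dD hD ddD] exD [epsD aD]] a.
have iJ := proj1 gJ; have [J0 JD JM] := iJ.
have cC : chain C by []. have cD : chain D by [].
have [phi0 cphi0 lphi0] := resolution_lift iJ cC cD exD aC aD.
have cphi := homogenize_chain_map hC hD cphi0.
have lphi := lifts_id_homogenize gJ aC aD cphi0 lphi0.
have [psi [spsi cpsi] lpsi] := resolution_lift iJ cD cC exC aD aC.
have {cphi0 lphi0} [sphi cphi'] := cphi.
pose theta c := act (homogenize phi0 c) psi - basis_vector c.
have ctheta : chain_map theta.
  apply: chain_mapB.
    split=> [c|c]; first by apply: in_step_act (sphi c) _ => b <-; apply: spsi.
    rewrite -act_act cphi' !bdE !act_act; apply: eq_act => b _.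
    by rewrite cpsi bdE.
  split=> [c|c]; first exact: in_step_basis.
  rewrite bdE act_basis; apply/ffunP => b.
  rewrite ffunE (bigD1 b) //= !ffunE eqxx mulr1 big1 ?addr0 // => c' /negPf nc.
  by rewrite !ffunE eq_sym nc mulr0.
have [|s ss es] := null_homotopy cC cC exC ctheta.
  move=> c hc; have [_ _ aC3] := aC; apply/aC3.
    by rewrite -hc; case: ctheta.
  rewrite -/(augment epsC (theta c)) /theta augmentB augment_basis augment_act.
  rewrite -[X in J (X - _)](subrK (augment epsD (homogenize phi0 c))) -addrA.
  apply: JD; last exact: lphi.
  rewrite {2}/augment -sumrB; apply: ideal_like_sum => // b _.
  rewrite -mulrBr; have [hb|/eqP hb] := eqVneq (hdeg b) 0%N.
    by apply: JM; apply: lpsi.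
  by rewrite sphi ?hc // mul0r.
have c0 : (theta a a)@_0%MM = 0.
  rewrite es bdE !ffunE raddfD /= !raddf_sum /= !big1 ?addr0 // => c _.
    by rewrite rmorphM /= ffunE mC mulr0.
  by rewrite rmorphM /= ffunE mC mul0r.
have : exists b, (homogenize phi0 a b)@_0%MM != 0.
  apply/existsP; apply: contraT => /existsPn h0; move: c0.
  rewrite /theta !ffunE eqxx raddfB /= raddf_sum /= big1 ?sub0r => [/eqP|b _].
    by rewrite mcoeff1 eqxx oppr_eq0 oner_eq0.
  by move/negPn/eqP: (h0 b) => hb0; rewrite rmorphM /= hb0 mul0r.
move=> [b nb]; exists b.
  apply: in_step_neq0 (sphi a) _; apply: contraNneq nb => ->.
  by rewrite mcoeff0.
apply/eqP; rewrite eq_sym -subr_eq0; apply/eqP.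
by apply: homog_of_deg_const nb; rewrite ffunE; apply: hpart_homog.
Qed.

End MinimalResolutions.

(** * The dual mapping cone is a resolution *)

Section DualCone.
Variables (k : fieldType) (m n : nat).
Local Notation R := {mpoly k[m]}.
Local Notation chains := {ffun {set 'I_n} -> R}.

Lemma sum_sig (I : finType) (P : pred I) (F : I -> R) :
  (forall i, ~~ P i -> F i = 0) -> \sum_(i : {i | P i}) F (val i) = \sum_i F i.
Proof.
move=> F0; rewrite [RHS](bigID P) /= [X in _ + X]big1 ?addr0 //.
rewrite [RHS](reindex_omap (val : {i | P i} -> I) insub) /=.
  by apply: eq_bigl => i; rewrite valK eqxx (valP i).
by move=> i Pi; rewrite insubT.
Qed.

Lemma koszul_homog (d : 'I_n -> nat) (f : 'I_n -> R) (S T : {set 'I_n}) :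
  (forall i, f i \is (d i).-homog) ->
  homog_of_deg ((\sum_(t in S) d t)%N%:Z - (\sum_(t in T) d t)%N%:Z) (koszul_diff f S T).
Proof.
move=> hf; apply: homog_of_deg_sum => t /andP[tS /eqP ->].
rewrite (big_setD1 t) //= PoszD addrK -[X in homog_of_deg X]add0r.
apply: homog_of_degM; [exact: homog_of_deg_sign | exact/homog_of_deg_nat].
Qed.

Lemma sum_setC (d : 'I_n -> nat) (S : {set 'I_n}) :
  (\sum_(t in ~: S) d t)%N%:Z = (\sum_(t < n) d t)%N%:Z - (\sum_(t in S) d t)%N%:Z.
Proof.
rewrite [in RHS](bigID (mem S)) /= PoszD addrAC subrr add0r.
by congr (Posz _); apply: eq_bigl => t; rewrite inE.
Qed.

Lemma shift_card_setC (S : {set 'I_n}) : (n.+1 - #|~: S|)%N = #|S|.+1.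
Proof. by have := cardsC S; rewrite card_ord; lia. Qed.

Variables (d e : 'I_n -> nat) (f g : 'I_n -> R).
Variable phi : {set 'I_n} -> {set 'I_n} -> R.
Let f' := alternate f.
Let g' := alternate g.
Local Notation F' := (koszul d f').
Local Notation G' := (koszul e g').
Local Notation bdF := (@bd k m F').
Local Notation bdG := (@bd k m G').
Local Notation P := (dual_cone d e f g phi).
Let phi_row (S : {set 'I_n}) : chains := [ffun T : {set 'I_n} => phi S T].
Let psi := dualize phi_row.

(** Complements turn the two dual Koszul complexes into Koszul complexes, so
    that a chain of the cone is a pair of Koszul chains (u, w).  The values at
    setT belong to the two generators that were cancelled and are discarded;
    they will be required to vanish. *)
Definition cone_chain (u w : chains) : {ffun cone_gen n -> R} :=
  [ffun x => match x with inl B => u (val B) | inr T => w (~: val T) end].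

Lemma cone_chainP (v : {ffun cone_gen n -> R}) :
  exists u w : chains, [/\ u setT = 0, w setT = 0 & v = cone_chain u w].
Proof.
pose u (B : {set 'I_n}) : R :=
  if (insub B : option {B : {set 'I_n} | B != setT}) is Some b then v (inl b) else 0.
pose w (C : {set 'I_n}) : R :=
  if (insub (~: C) : option {T : {set 'I_n} | T != set0}) is Some c
  then v (inr c) else 0.
exists [ffun B => u B], [ffun C => w C].
split; rewrite ?ffunE.
- by rewrite /u insubF ?eqxx.
- by rewrite /w setCT insubF ?eqxx.
by apply/ffunP => -[B|T]; rewrite !ffunE /u /w ?setCK valK.
Qed.

Lemma in_step_cone i (u w : chains) :
  @in_step k m G' i.+1 u -> @in_step k m F' i w ->
  @in_step k m P i.+1 (cone_chain u w).
Proof.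
move=> su sw [B|T] /= hb; rewrite ffunE; [exact: su | apply: sw => /= ec; apply: hb].
apply: etrans (esym (congr1 (fun U : {set 'I_n} => n.+1 - #|U|)%N (setCK (val T)))) _.
by rewrite shift_card_setC ec.
Qed.

Lemma in_step_cone_inv i (u w : chains) : u setT = 0 -> w setT = 0 ->
  @in_step k m P i.+1 (cone_chain u w) ->
  @in_step k m G' i.+1 u /\ @in_step k m F' i w.
Proof.
move=> uT wT h; split=> S /= hS.
  have [->//|nS] := eqVneq S setT.
  by have := h (inl (exist _ S nS)) hS; rewrite ffunE.
have [->//|nS] := eqVneq S setT.
have nC : ~: S != set0 by rewrite -setCT (inj_eq (@setC_inj _)).
have := h (inr (exist _ (~: S) nC)); rewrite ffunE /= setCK; apply.
move=> e0; apply: hS; apply: succn_inj; exact: etrans (esym (shift_card_setC S)) e0.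
Qed.

Lemma in_step0_cone (u w : chains) : w setT = 0 ->
  @in_step k m P 0 (cone_chain u w) -> u setT = 0 ->
  u = scalar_chain n (u set0) /\ w = 0.
Proof.
move=> wT h uT; split; apply/ffunP => S; rewrite [RHS]ffunE.
  case: eqP => [->//|nS0]; have [->//|nS] := eqVneq S setT.
  have := h (inl (exist _ S nS)); rewrite ffunE /=; apply.
  by move/cards0_eq.
have [->//|nS] := eqVneq S setT.
have nC : ~: S != set0 by rewrite -setCT (inj_eq (@setC_inj _)).
have := h (inr (exist _ (~: S) nC)); rewrite ffunE /= setCK; apply.
by move=> e0; have := etrans (esym (shift_card_setC S)) e0.
Qed.

Lemma bd_cone (u w : chains) : u setT = 0 -> w setT = 0 ->
  @bd k m P (cone_chain u w) = cone_chain (bdG u + act w psi) (- bdF w).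
Proof.
move=> uT wT; apply/ffunP => -[B'|T']; rewrite !ffunE big_sumType /=.
  congr (_ + _).
    rewrite -(@sum_sig _ (fun B => B != setT) (fun B => u B * koszul_diff g' B (val B'))).
      by apply: eq_bigr => B _; rewrite ffunE koszul_diff_compl.
    by move=> B /negPn/eqP ->; rewrite uT mul0r.
  rewrite [RHS](reindex_inj (@setC_inj _)) /=.
  rewrite -(@sum_sig _ (fun T => T != set0) (fun T => w (~: T) * psi (~: T) (val B'))).
    by apply: eq_bigr => T _; rewrite !ffunE setCK.
  by move=> T /negPn/eqP ->; rewrite setC0 wT mul0r.
rewrite big1 => [|B _]; last by rewrite mulr0.
rewrite add0r [in RHS](reindex_inj (@setC_inj _)) /= -sumrN.
rewrite -(@sum_sig _ (fun T => T != set0)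
   (fun T => - (w (~: T) * koszul_diff f' (~: T) (~: val T')))).
  by apply: eq_bigr => T _; rewrite !ffunE mulrN -koszul_diff_compl !setCK.
by move=> T /negPn/eqP ->; rewrite setC0 wT mul0r oppr0.
Qed.

Lemma cone_chain0 : cone_chain 0 0 = 0.
Proof. by apply/ffunP => -[B|T]; rewrite !ffunE. Qed.

Lemma diff_cone_inl B : @diff k m P (inl B) = cone_chain (@diff k m G' (val B)) 0.
Proof. by apply/ffunP => -[B'|T']; rewrite !ffunE //= koszul_diff_compl. Qed.

Lemma diff_cone_inr T : @diff k m P (inr T) =
  cone_chain (psi (~: val T)) (- @diff k m F' (~: val T)).
Proof.
apply/ffunP => -[B'|T']; rewrite !ffunE ?setCK //=.
by rewrite -koszul_diff_compl !setCK.
Qed.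

Hypothesis n_gt1 : (1 < n)%N.
Hypothesis f_homog : forall i, f i \is (d i).-homog.
Hypothesis g_homog : forall i, g i \is (e i).-homog.
Hypothesis f_regular : regular_sequence f.
Hypothesis g_regular : regular_sequence g.
Hypothesis phi_lifts : lifts_inclusion d e f g phi.

Lemma phi_row_chain : @chain_map k m (koszul e g) (koszul d f) phi_row.
Proof.
have [[sp _ cp] _] := phi_lifts; split=> [a b hb|a].
  by rewrite ffunE sp // => e'; apply: hb.
apply/ffunP => b; rewrite !ffunE -[LHS](_ : \sum_c gdiff (a : koszul e g) c * phi c b = _).
  by rewrite cp; apply: eq_bigr => c _; rewrite ffunE.
by apply: eq_bigr => c _; rewrite !ffunE.
Qed.

Lemma phi_row0 : phi_row set0 set0 = 1.
Proof. by rewrite ffunE; case: phi_lifts. Qed.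

Lemma psi_chain : @chain_map k m F' G' psi.
Proof. exact: dual_phi_chain phi_row_chain. Qed.

Lemma psi_setT : psi setT setT = 1.
Proof. by rewrite ffunE setCT phi_row0. Qed.

Lemma bd_act_psi (w : chains) : bdG (act w psi) = act (bdF w) psi.
Proof.
rewrite !bdE !act_act; apply: eq_act => a _; rewrite -bdE.
by have [_ ->] := psi_chain.
Qed.

Lemma act_psi_setT (w : chains) : act w psi setT = w setT.
Proof.
rewrite ffunE (bigD1 setT) //= psi_setT mulr1 big1 ?addr0 // => C nC.
by rewrite (row_setT psi_chain nC) mulr0.
Qed.

Lemma act_psi_scalar q : act (scalar_chain n q) psi = scalar_chain n (q * phi setT setT).
Proof.
have e0 := row_set0 psi_chain.
apply/ffunP => S; rewrite ffunE (bigD1 set0) //= ffunE eqxx e0 big1 ?addr0.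
  by rewrite !ffunE setC0; case: ifP; rewrite ?mulr0.
by move=> C /negPf nC; rewrite ffunE nC mul0r.
Qed.

(** Exactness of the cone before the cancellation: the source and the target
    of psi are acyclic, and in degree 0 psi is injective on homology. *)
Lemma full_cone_acyclic i (u w : chains) :
  @in_step k m G' i.+1 u -> @in_step k m F' i w ->
  bdG u + act w psi = 0 -> bdF w = 0 ->
  exists u1 w1 : chains, [/\ @in_step k m G' i.+2 u1, @in_step k m F' i.+1 w1,
    u = bdG u1 + act w1 psi & w = - bdF w1].
Proof.
move=> su sw eu ew.
have exF := koszul_acyclic (d := d) (alternate_regular f_regular).
have exG := koszul_acyclic (d := e) (alternate_regular g_regular).
have [w1 sw1 ew1] : exists2 w1, @in_step k m F' i.+1 w1 & w = bdF w1.
  case: i su sw => [|i] su sw; last exact: exF.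
  have w0 : w = scalar_chain n (w set0).
    apply/ffunP => S; rewrite [RHS]ffunE; case: eqP => [->//|nS].
    by apply: sw => /= /cards0_eq.
  suff /span_alternate/(ideal_koszul d) [w1 sw1 ew1] : ideal f (w set0).
    by exists w1; rewrite // w0.
  apply: (link_injective g_regular phi_row_chain phi_row0); rewrite ffunE.
  apply/span_alternate/(ideal_koszul e); exists (- u); first exact: in_stepN.
  rewrite -act_psi_scalar -w0 bdN; apply/eqP.
  by rewrite -addr_eq0 addrC eu.
have [||u1 su1 eu1] := exG i (u + act w1 psi).
- apply: in_stepD su _; apply: (in_step_act sw1) => C <-.
  by case: psi_chain.
- by rewrite bdD bd_act_psi -ew1.
exists u1, (- w1); split=> //; first exact: in_stepN.
  by rewrite actN -eu1 addrK.
by rewrite bdN opprK.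
Qed.

(** A boundary in the full cone may use the two cancelled generators.  The
    coefficient of the one of degree n.+1 vanishes because the cycle has no
    component on the other one.  The coefficient of the one of degree n is
    removed by subtracting the boundary of a multiple of the generator of degree
    n.+1, in which it occurs with coefficient 1. *)
Lemma dual_cone_acyclic : acyclic P.
Proof.
move=> i v sv bv.
have [u [w [uT wT ev]]] := cone_chainP v.
have [su sw] : @in_step k m G' i.+1 u /\ @in_step k m F' i w.
  by apply: in_step_cone_inv => //; rewrite -ev.
have eT : (bdG u + act w psi) setT = 0.
  by rewrite ffunE act_psi_setT wT bd_koszul_setT addr0.
have eT' : (- bdF w : chains) setT = 0 by rewrite ffunE bd_koszul_setT oppr0.
have e0 := bd_cone uT wT; rewrite -ev bv in e0.
have eu : bdG u + act w psi = 0.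
  apply/ffunP => B; rewrite [RHS]ffunE; have [->//|nB] := eqVneq B setT.
  have := congr1 (fun x : {ffun cone_gen n -> R} => x (inl (exist _ B nB))) e0.
  by rewrite [RHS]ffunE ffunE => <-.
have ew : bdF w = 0.
  apply/eqP; rewrite -oppr_eq0; apply/eqP.
  apply/ffunP => C; rewrite [RHS]ffunE; have [->//|nC] := eqVneq C setT.
  have nC' : ~: C != set0 by rewrite -setCT (inj_eq (@setC_inj _)).
  have := congr1 (fun x : {ffun cone_gen n -> R} => x (inr (exist _ (~: C) nC'))) e0.
  by rewrite [RHS]ffunE /= setCK [LHS]ffunE => <-.
have [u1 [w1 [su1 sw1 eu1 ew1]]] := full_cone_acyclic su sw eu ew.
have w1T : w1 setT = 0.
  by move: uT; rewrite eu1 ffunE bd_koszul_setT act_psi_setT add0r.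
(* The multiple of the cancelled generator of degree n.+1 whose boundary is
   subtracted. *)
pose z : chains := [ffun C => if C == setT then u1 setT else 0].
have sz : @in_step k m F' i.+2 z.
  by move=> C hC; rewrite ffunE; case: eqP => // e'; apply: su1; rewrite -e'.
exists (cone_chain (u1 - act z psi) (w1 + bdF z)).
  apply: in_step_cone.
    by apply: in_stepB su1 _; apply: (in_step_act sz) => C <-; case: psi_chain.
  by apply: in_stepD sw1 _; apply: in_step_bd (koszul_chain _ _) sz.
rewrite bd_cone.
- rewrite ev; congr cone_chain.
    by rewrite eu1 bdB bd_act_psi actD [act w1 psi + _]addrC addrA subrK.
  by rewrite bdD koszul_bd_bd addr0.
- rewrite ffunE [X in _ + X]ffunE act_psi_setT.
  by rewrite ffunE eqxx subrr.
by rewrite ffunE bd_koszul_setT w1T addr0.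
Qed.

Lemma dual_cone_complex : is_complex P.
Proof.
have cP : forall a : P, bd (@diff k m P a) = 0.
  case=> [B|T].
    rewrite diff_cone_inl bd_cone ?ffunE //; last exact: koszul_diff_setT_r.
    rewrite act0 addr0 bd0 oppr0 (bd_diff _ (koszul_chain _ _)).
    exact: cone_chain0.
  have nT : ~: val T != setT.
    by rewrite -(inj_eq (@setC_inj _)) setCK setCT (valP T).
  rewrite diff_cone_inr bd_cone; last 2 first.
  - exact: row_setT psi_chain nT.
  - by rewrite !ffunE /= koszul_diff_setT_r oppr0.
  rewrite actN bdN opprK; have [_ <-] := psi_chain.
  rewrite subrr (bd_diff _ (koszul_chain _ _)); exact: cone_chain0.
split.
- move=> [B|T] [B'|T'] //= h.
  + rewrite koszul_diff_compl.
    by apply: (proj1 (koszul_chain e g')).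
  + have [[sp _ _] _] := phi_lifts; apply: sp => /= ec; apply: h.
    by rewrite -ec shift_card_setC.
  + rewrite -[val T]setCK -[val T']setCK koszul_diff_compl.
    apply/eqP; rewrite oppr_eq0; apply/eqP.
    apply: (proj1 (koszul_chain d f')) => /= ec; apply: h.
    have := shift_card_setC (~: val T); have := shift_card_setC (~: val T').
    by rewrite !setCK => -> ->; rewrite -ec.
- have [[_ hp _] _] := phi_lifts.
  move=> [B|T] [B'|T'] /=.
  + have := @koszul_homog e g (~: val B') (~: val B) g_homog.
    by congr homog_of_deg; rewrite !sum_setC; ring.
  + exact: homog_of_deg0.
  + have := hp (~: val B') (val T).
    by congr homog_of_deg; rewrite /= sum_setC; ring.
  + have := @koszul_homog d f (val T') (val T) f_homog.
    move/homog_of_degN; congr homog_of_deg; ring.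
move=> a c; have := congr1 (fun x : {ffun cone_gen n -> R} => x c) (cP a).
rewrite [RHS]ffunE [LHS]ffunE => {2}<-.
by apply: eq_bigr => b _; rewrite ffunE.
Qed.

Definition cone_eps (b : P) : R :=
  match b with inl B => (val B == set0)%:R | inr _ => 0 end.

Lemma augment_cone (u w : chains) : augment cone_eps (cone_chain u w) = u set0.
Proof.
have n0 : (set0 : {set 'I_n}) != setT.
  by apply/eqP => /setP/(_ (Ordinal (ltnW n_gt1))); rewrite !inE.
rewrite /augment big_sumType /= [X in _ + X]big1 ?addr0 => [|T _]; last by rewrite mulr0.
rewrite (bigD1 (exist _ set0 n0)) //= ffunE eqxx mulr1 big1 ?addr0 // => B nB.
by rewrite -val_eqE /= in nB; rewrite (negPf nB) mulr0.
Qed.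

Lemma set_le1_neqT (S : {set 'I_n}) : (#|S| <= 1)%N -> S != setT.
Proof.
by move=> S1; apply: contraTneq n_gt1 => eS; move: S1; rewrite eS cardsT card_ord ltnNge => ->.
Qed.

Lemma dual_cone_resolution : is_free_resolution (colon (ideal g) (ideal f)) P.
Proof.
have set0T : (set0 : {set 'I_n}) != setT by apply: set_le1_neqT; rewrite cards0.
have sT c : scalar_chain n c setT = 0 :> R by rewrite ffunE eq_sym (negPf set0T).
split; [exact: dual_cone_complex | exact: dual_cone_acyclic|].
exists cone_eps; split.
- move=> [B|T] /= hB; last exact: homog_of_deg0.
  by rewrite (cards0_eq hB) eqxx big_set0; apply: homog_of_deg1.
- exists (cone_chain (scalar_chain n 1) 0).
    move=> [B|T] /= hb; rewrite ffunE // ?ffunE //.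
    by case: eqP => // B0; case: hb; rewrite B0 cards0.
  rewrite -/(augment _ _) augment_cone ffunE eqxx subrr.
  by move=> q _; rewrite mul0r; apply: span0.
move=> v sv; have [u [w [uT wT ev]]] := cone_chainP v.
rewrite ev in sv *; have [eu ew] := in_step0_cone wT sv uT.
rewrite -/(augment _ _) augment_cone.
rewrite (link_colon f_regular g_regular phi_row_chain phi_row0).
split.
  move=> [q /span_alternate/(ideal_koszul e) [u1 su1 eu1]].
  have u1T : u1 setT = 0.
    by apply: su1 => /= cT; move: n_gt1; rewrite -[n in (1 < n)%N]card_ord -cardsT cT.
  have sq : @in_step k m F' 0 (scalar_chain n q).
    by move=> S hS; rewrite ffunE; case: eqP => // S0; case: hS; rewrite S0 /= cards0.
  exists (cone_chain u1 (scalar_chain n q)); first exact: in_step_cone.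
  rewrite bd_cone // -eu1 act_psi_scalar (bd_bottom (koszul_chain _ _) sq).
  rewrite oppr0 ew; congr cone_chain; apply: (etrans eu); apply/ffunP => S; rewrite !ffunE.
  by case: eqP => _; rewrite ?addr0 // subrK.
move=> [w' sw' ew']; have [u1 [w1 [u1T w1T e1]]] := cone_chainP w'.
have [su1 sw1] : @in_step k m G' 1 u1 /\ @in_step k m F' 0 w1.
  by apply: in_step_cone_inv => //; rewrite -e1.
exists (w1 set0).
have := congr1 (augment cone_eps) ew'; rewrite e1 bd_cone // !augment_cone => ->.
have ew1 : w1 = scalar_chain n (w1 set0).
  apply/ffunP => S; rewrite [RHS]ffunE; case: eqP => [->//|nS].
  by apply: sw1 => /= /cards0_eq.
have e2 : act w1 psi set0 = w1 set0 * phi setT setT.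
  by rewrite {1}ew1 act_psi_scalar ffunE eqxx.
rewrite ffunE e2 [X in _ - _ * X]ffunE addrK koszul_bd_set0.
apply/span_alternate; apply: span_sum => t _; apply: spanM; exact: span_mem.
Qed.

End DualCone.

(** * Hilbert functions *)

Section GradedDimension.
Variables (k : fieldType) (m : nat).
Local Notation R := {mpoly k[m]}.
Implicit Types (J A B C : R -> Prop) (p q : R) (t s h : nat).

Definition comb h (b : 'I_h -> R) (c : 'I_h -> k) : R := \sum_(i < h) c i *: b i.

Definition spanning J t h (b : 'I_h -> R) : Prop :=
  (forall i, b i \is t.-homog) /\
  (forall p, p \is t.-homog -> exists c, J (p - comb b c)).

Definition independent J h (b : 'I_h -> R) : Prop :=
  forall c, J (comb b c) -> forall i, c i = 0.

Lemma combB h (b : 'I_h -> R) c c' :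
  comb b c - comb b c' = comb b (fun i => c i - c' i).
Proof. by rewrite /comb -sumrB; apply: eq_bigr => i _; rewrite scalerBl. Qed.

Lemma ideal_likeZ J (a : k) p : ideal_like J -> J p -> J (a *: p).
Proof. by move=> [_ _ JM] hp; rewrite -mul_mpolyC; apply: JM. Qed.

Lemma graded_dimP J t h : ideal_like J ->
  is_graded_dim J t h <-> exists b : 'I_h -> R, spanning J t b /\ independent J b.
Proof.
move=> iJ; split=> [[b [hb ub]]|[b [[hb sb] ib]]]; exists b.
  split; [split=> // p /ub [c [hc _]]; by exists c|].
  move=> c hc i; have z0 : (0 : R) \is t.-homog by apply: dhomog0.
  have [c0 [h0 u0]] := ub 0 z0.
  have e1 : c0 = [ffun=> 0].
    apply: u0; rewrite sub0r; apply: ideal_likeN => //.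
    by rewrite big1 => [|j _]; [case: iJ | rewrite ffunE scale0r].
  have : c0 = [ffun j => c j].
    apply: u0; rewrite sub0r; apply: ideal_likeN => //.
    by under eq_bigr => j _ do rewrite ffunE.
  by rewrite e1 => /ffunP/(_ i); rewrite !ffunE.
split=> // p hp; have [c hc] := sb p hp; exists [ffun i => c i]; split.
  by under eq_bigr => i _ do rewrite ffunE.
move=> c' hc'; apply/ffunP => i; rewrite ffunE; apply/eqP; rewrite -subr_eq0; apply/eqP.
apply: (ib (fun i => c i - c' i)); rewrite -combB.
rewrite (_ : _ - _ = (p - comb b c') - (p - comb b c)); last by ring.
exact: ideal_likeB.
Qed.

Lemma comb_mod J h h' (b : 'I_h -> R) (b' : 'I_h' -> R) (M : 'M[k]_(h, h')) c :
  ideal_like J -> (forall i, J (b i - comb b' (M i))) ->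
  J (comb b c - comb b' (fun j => \sum_i c i * M i j)).
Proof.
move=> iJ hM.
have -> : comb b' (fun j => \sum_i c i * M i j) = \sum_i c i *: comb b' (M i).
  under [RHS]eq_bigr => i _ do rewrite scaler_sumr.
  rewrite exchange_big; apply: eq_bigr => j _; rewrite scaler_suml.
  by apply: eq_bigr => i _; rewrite scalerA.
rewrite /comb -sumrB; apply: ideal_like_sum => // i _.
by rewrite -scalerBr; apply: ideal_likeZ.
Qed.

Lemma matrix_choice h h' (Q : 'I_h -> ('I_h' -> k) -> Prop) :
  (forall i, exists c, Q i c) ->
  (forall i c c', c =1 c' -> Q i c -> Q i c') ->
  exists M : 'M[k]_(h, h'), forall i, Q i (M i).
Proof.
move=> ex ext; have [F hF] := fin_all_exists ex.
exists (\matrix_(i, j) F i j) => i; apply: ext (hF i) => j; by rewrite mxE.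
Qed.

(** Expressing b in terms of b' and b' in terms of b gives matrices whose
    product is the identity by independence of b. *)
Lemma independent_le_spanning J t h h' (b : 'I_h -> R) (b' : 'I_h' -> R) :
  ideal_like J -> spanning J t b -> independent J b -> spanning J t b' -> (h <= h')%N.
Proof.
move=> iJ [hb sb] ib [hb' sb'].
have ext r (a : 'I_r -> R) p c c' : c =1 c' -> J (p - comb a c) -> J (p - comb a c').
  by move=> e; rewrite (_ : comb a c = comb a c') //; apply: eq_bigr => i _; rewrite e.
have [M hM] := matrix_choice (fun i => sb' (b i) (hb i)) (fun i => ext _ b' (b i)).
have [N hN] := matrix_choice (fun i => sb (b' i) (hb' i)) (fun i => ext _ b (b' i)).
apply: (@mulmx1_min k h h' M N); apply/matrixP => i l.
(* The relation saying that b i equals its expansion through b' and back. *)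
have hi : J (comb b (fun l => (i == l)%:R - (M *m N) i l)).
  rewrite -combB (_ : comb b _ = b i); last first.
    rewrite /comb (bigD1 i) //= eqxx scale1r big1 ?addr0 // => j /negPf nj.
    by rewrite eq_sym nj scale0r.
  have := comb_mod (M i) iJ hN; rewrite (_ : comb b _ = comb b ((M *m N) i)).
    move=> h1; rewrite -[b i](subrK (comb b' (M i))) -addrA.
    by case: (iJ) => _ JD _; apply: JD.
  by apply: eq_bigr => j _; rewrite mxE.
have /eqP := ib _ hi l; rewrite subr_eq0 => /eqP <-; by rewrite mxE.
Qed.

Lemma graded_dim_unique J t h h' : ideal_like J ->
  is_graded_dim J t h -> is_graded_dim J t h' -> h = h'.
Proof.
move=> iJ /(graded_dimP _ _ iJ) [b [sb ib]] /(graded_dimP _ _ iJ) [b' [sb' ib']].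
by apply/eqP; rewrite eqn_leq (independent_le_spanning iJ sb ib sb')
  (independent_le_spanning iJ sb' ib' sb).
Qed.

(** The components of degree t of the finitely many monomials of degree at
    most t. *)
Lemma spanning_exists J t : ideal_like J -> exists h (b : 'I_h -> R), spanning J t b.
Proof.
move=> iJ; pose T := 'X_{1..m < t.+1}.
pose b (i : 'I_#|{: T}|) : R := pihomog mdeg t 'X_[enum_val i : T].
exists #|{: T}|, b; split=> [i|p hp]; first exact: pihomogP.
exists (fun i => p@_(enum_val i : T)).
have -> : comb b (fun i => p@_(enum_val i : T)) = p.
  rewrite -{2}(pihomog_dE hp) [in RHS](mpolywE (k := t.+1) (p := p)).
    rewrite linear_sum /= /comb.
    rewrite [RHS](reindex_onto enum_val enum_rank) => [|i _]; last exact: enum_rankK.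
    rewrite [RHS](eq_bigl xpredT) => [|i]; last by rewrite enum_valK eqxx.
    by apply: eq_bigr => i _; rewrite linearZ.
  rewrite msizeE; apply/bigmax_leqP_seq => u hu _.
  by have /dhomogP/(_ u hu) -> := hp.
by rewrite subrr; case: iJ.
Qed.

(** A spanning family of least size is independent, since a relation lets one
    discard a member. *)
Lemma graded_dim_exists J t : ideal_like J -> exists h, is_graded_dim J t h.
Proof.
move=> iJ; have [h [b sb]] := spanning_exists t iJ.
elim: h b sb => [|h IH] b sb.
  exists 0%N; apply/graded_dimP => //; exists b; split=> // c _; by case.
have [ib|] := classic (independent J b).
  by exists h.+1; apply/graded_dimP => //; exists b.
move=> nib; have [c nc] := not_all_ex_not _ _ nib.
have [hc nc0] := imply_to_and _ _ nc; have [j /eqP cj] := not_all_ex_not _ _ nc0.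
apply: (IH (fun i => b (lift j i))); have [hb {}sb] := sb.
split=> [i|p hp]; first exact: hb.
have [a ha] := sb p hp.
exists (fun i => a (lift j i) - a j / c j * c (lift j i)).
have -> : comb (fun i => b (lift j i)) (fun i => a (lift j i) - a j / c j * c (lift j i))
    = comb b a - (a j / c j) *: comb b c.
  rewrite /comb (bigD1_ord j) //= [in X in _ - X](bigD1_ord j) //= scalerDr scalerA.
  rewrite divfK // [RHS]addrAC opprD addrA subrr sub0r addrC scaler_sumr -sumrB.
  by apply: eq_bigr => i _; rewrite scalerBl scalerA.
rewrite opprB addrA addrAC; case: (iJ) => _ JD _.
by apply: JD => //; apply: ideal_likeZ.
Qed.

Definition hilb J t : nat := epsilon (inhabits 0%N) (is_graded_dim J t).

Lemma hilbP J t : ideal_like J -> is_graded_dim J t (hilb J t).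
Proof. by move=> iJ; apply: epsilon_spec; apply: graded_dim_exists. Qed.

Lemma hilb_unique J t h : ideal_like J -> is_graded_dim J t h -> hilb J t = h.
Proof. by move=> iJ; apply: graded_dim_unique (hilbP t iJ). Qed.

Lemma hilb_anti A B t : ideal_like A -> ideal_like B ->
  (forall p, A p -> B p) -> (hilb B t <= hilb A t)%N.
Proof.
move=> iA iB AB.
have /(graded_dimP _ _ iA) [a [[ha sa] _]] := hilbP t iA.
have /(graded_dimP _ _ iB) [b [sb ib]] := hilbP t iB.
apply: independent_le_spanning iB sb ib _; split; [exact: ha|].
by move=> p /sa [c hc]; exists c; apply: AB.
Qed.

Lemma hilb_iff A B t : ideal_like A -> ideal_like B ->
  (forall p, A p <-> B p) -> hilb A t = hilb B t.
Proof.
by move=> iA iB AB; apply/eqP; rewrite eqn_leq !hilb_anti // => p /AB.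
Qed.

Section Extension.
Variables (A C : R -> Prop) (D : R) (s : nat).
Hypotheses (gA : graded_ideal A) (iC : ideal_like C) (D_homog : D \is s.-homog).
Hypothesis A_C : forall q, A (q * D) <-> C q.

Definition adjoin p : Prop := exists q, A (p - q * D).

Lemma adjoin_ideal_like : ideal_like adjoin.
Proof.
have [[A0 AD AM] _] := gA; split.
- by exists 0; rewrite mul0r subrr.
- move=> p q [a ha] [b hb]; exists (a + b).
  by rewrite mulrDl opprD addrACA; apply: AD.
by move=> p q [a ha]; exists (p * a); rewrite -mulrA -mulrBr; apply: AM.
Qed.

Lemma adjoin_homog t p : p \is t.-homog -> adjoin p ->
  exists2 q, homog_of_deg (t%:Z - s%:Z) q & A (p - q * D).
Proof.
move=> hp [q hq]; exists (hpart (t%:Z - s%:Z) q); first exact: hpart_homog.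
have := proj2 gA t%:Z _ hq; rewrite hpartD hpartN hpart_id; last exact/homog_of_deg_nat.
have e : t%:Z = (t%:Z - s%:Z) + s%:Z :> int by rewrite subrK.
by rewrite {1}e hpartMr //; apply/homog_of_deg_nat.
Qed.

(** Additivity of dimension along 0 -> R/C -> R/A -> R/(A + (D)) -> 0, where
    the first map is multiplication by D and shifts degrees by s. *)
Lemma hilb_adjoin_ge t : (s <= t)%N ->
  hilb A t = (hilb adjoin t + hilb C (t - s))%N.
Proof.
move=> st; have iA := proj1 gA; have iB := adjoin_ideal_like.
have [_ AD AM] := iA.
have /(graded_dimP _ _ iB) [b [[hb sb] ib]] := hilbP t iB.
have /(graded_dimP _ _ iC) [c [[hc sc] ic]] := hilbP (t - s) iC.
apply: hilb_unique => //; apply/graded_dimP => //.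
pose a (i : 'I_(hilb adjoin t + hilb C (t - s))) : R :=
  match split i with inl j => b j | inr l => c l * D end.
have comb_a x : comb a x =
    comb b (fun j => x (lshift _ j)) + comb c (fun l => x (rshift _ l)) * D.
  rewrite /comb big_split_ord /=; congr (_ + _).
    by apply: eq_bigr => j _; rewrite /a -/(unsplit (inl j)) unsplitK.
  rewrite mulr_suml; apply: eq_bigr => l _.
  by rewrite /a -/(unsplit (inr l)) unsplitK scalerAl.
exists a; split; [split=> [i|p hp] | move=> x hx i].
- rewrite /a; case: (split i) => [j|l]; first exact: hb.
  by rewrite -(subnK st); apply: dhomogM.
- have [x hx] := sb p hp.
  have hpx : p - comb b x \is t.-homog.
    by rewrite rpredB // rpred_sum // => j _; rewrite rpredZ.
  have [q hq hA] := adjoin_homog hpx hx.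
  have [y hy] : exists y, C (q - comb c y).
    by apply: sc; apply/homog_of_deg_nat; rewrite -subzn.
  exists (fun i => match split i with inl j => x j | inr l => y l end).
  rewrite comb_a (_ : comb b _ = comb b x); last first.
    by apply: eq_bigr => j _; rewrite -/(unsplit (inl j)) unsplitK.
  rewrite (_ : comb c _ = comb c y); last first.
    by apply: eq_bigr => l _; rewrite -/(unsplit (inr l)) unsplitK.
  rewrite (_ : _ - _ = (p - comb b x - q * D) + (q - comb c y) * D); last by ring.
  by apply: AD => //; apply/A_C.
have x1 : forall j, x (lshift _ j) = 0.
  apply: ib; exists (- comb c (fun l => x (rshift _ l))).
  by rewrite mulNr opprK -comb_a.
have x2 : forall l, x (rshift _ l) = 0.
  apply: ic; apply/A_C; move: hx; rewrite comb_a.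
  rewrite (_ : comb b _ = 0) ?add0r //.
  by rewrite /comb big1 // => j _; rewrite x1 scale0r.
by rewrite -(splitK i); case: (split i).
Qed.

Lemma hilb_adjoin_lt t : (t < s)%N -> hilb A t = hilb adjoin t.
Proof.
move=> ts; have iA := proj1 gA; have iB := adjoin_ideal_like.
have /(graded_dimP _ _ iB) [b [[hb sb] ib]] := hilbP t iB.
apply: hilb_unique => //; apply/graded_dimP => //; exists b.
split; [split=> // p hp | move=> x hx].
  have [x hx] := sb p hp; exists x.
  have hpx : p - comb b x \is t.-homog.
    by rewrite rpredB // rpred_sum // => j _; rewrite rpredZ.
  have [q hq] := adjoin_homog hpx hx.
  have [r er] : exists r, t%:Z - s%:Z = Negz r.
    by exists (s - t).-1; rewrite NegzE; lia.
  by move: hq; rewrite er => /homog_of_deg_neg ->; rewrite mul0r subr0.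
by apply: ib; exists 0; rewrite mul0r subr0.
Qed.

End Extension.

End GradedDimension.

(** * Eventually polynomial functions *)

Section EventuallyPolynomial.
Implicit Types (Q : {poly rat}) (h : nat -> nat) (D E c : nat).

Definition backward_shift c Q : {poly rat} := Q \Po ('X - (c%:R)%:P).

Lemma horner_backward_shift c Q (x : rat) : (backward_shift c Q).[x] = Q.[x - c%:R].
Proof. by rewrite horner_comp !hornerE. Qed.

(** The difference operator lowers the degree by one and multiplies the
    leading coefficient by c times the degree. *)
Lemma backward_difference c Q D : (size Q <= D.+1)%N ->
  (size (Q - backward_shift c Q)%R <= D)%N /\
  forall E, D = E.+1 -> (Q - backward_shift c Q)`_E = (E.+1 * c)%:R * Q`_E.+1.
Proof.
move: D; elim/poly_ind: Q => [|p a IH] D hs.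
  rewrite /backward_shift comp_poly0 subrr size_poly0; split=> // E _.
  by rewrite !coef0 mulr0.
have hp : (size p <= D)%N.
  by move: hs; rewrite size_MXaddC; case: ifP => [/andP[/eqP -> _]|_ //]; rewrite size_poly0.
have [q eq_q] : exists q, q = p - backward_shift c p by eexists.
have eq_diff : p * 'X + a%:P - backward_shift c (p * 'X + a%:P) =
    q * 'X + c%:R *: (p - q).
  rewrite /backward_shift comp_polyD comp_polyM comp_polyX comp_polyC -/(backward_shift c p).
  rewrite eq_q -mul_polyC; move: (backward_shift c p) (c%:R)%:P 'X a%:P => b u x v.
  by ring.
rewrite eq_diff; case: D hs hp => [|E] hs hp.
  move: hp; rewrite leqn0 size_poly_eq0 => /eqP p0.
  by rewrite eq_q p0 /backward_shift comp_poly0 !(subrr, mul0r, scaler0, addr0, size_poly0).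
have := IH E hp; rewrite -eq_q => -[sq cq].
split=> [|_ [<-]].
  apply/leq_sizeP => j hj; rewrite coefD coefMX coefZ coefB.
  rewrite (nth_default 0 (leq_trans hp hj)) (nth_default 0 (leq_trans sq (ltnW hj))).
  case: j hj => [//|j] hj /=; rewrite nth_default ?subr0 ?mulr0 ?addr0 //.
  exact: leq_trans sq _.
rewrite coefD coefMX coefZ coefB (nth_default 0 sq) subr0 coefD coefMX coefC /= addr0.
case: E {hs hp sq} cq => [|E] cq /=; first by rewrite add0r mul1n.
by rewrite cq // -mulrDl -natrD addnC.
Qed.

Lemma backward_shift_top c Q D : (size Q <= D.+1)%N ->
  (size (backward_shift c Q) <= D.+1)%N /\ (backward_shift c Q)`_D = Q`_D.
Proof.
move=> hs; have [sd _] := backward_difference c hs.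
have -> : backward_shift c Q = Q - (Q - backward_shift c Q) by rewrite subKr.
split; last by rewrite coefB [X in _ - X]nth_default // subr0.
rewrite (leq_trans (size_polyD _ _)) // size_polyN geq_max hs.
exact: leq_trans sd _.
Qed.

(** The normalization is such that, for the Hilbert function of a ring of
    dimension D.+1, the number a is the multiplicity; a = 0 allows for smaller
    dimension. *)
Definition hilbert_poly h D (a : rat) : Prop :=
  exists Q t0, [/\ forall t, (t0 <= t)%N -> (h t)%:R = Q.[t%:R],
    (size Q <= D.+1)%N & Q`_D * D`!%:R = a].

Lemma hilbert_poly_adjoin hA hB s D a :
  (forall t, (s <= t)%N -> hA t = hB t + hA (t - s))%N ->
  hilbert_poly hA D.+1 a -> hilbert_poly hB D (s%:R * a).
Proof.
move=> h [Q [t0 [hQ sQ <-]]]; have [sd cd] := backward_difference s sQ.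
exists (Q - backward_shift s Q), (t0 + s)%N; split=> // [t ht|].
  have st : (s <= t)%N by apply: leq_trans ht; apply: leq_addl.
  rewrite hornerD hornerN horner_backward_shift -natrB // -!hQ.
  - by rewrite h // natrD addrK.
  - by rewrite leq_subRL // addnC.
  - by apply: leq_trans ht; apply: leq_addr.
rewrite (cd D) // factS !natrM; ring.
Qed.

Lemma hilbert_poly_adjoin0 hA hB s a :
  (forall t, (s <= t)%N -> hA t = hB t + hA (t - s))%N ->
  hilbert_poly hA 0 a -> exists t0, forall t, (t0 <= t)%N -> hB t = 0%N.
Proof.
move=> h [Q [t0 [hQ /size1_polyC eQ _]]]; exists (t0 + s)%N => t ht.
have st : (s <= t)%N by apply: leq_trans ht; apply: leq_addl.
have : hA t = hA (t - s)%N.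
  have ev (x : rat) : Q.[x] = Q`_0 by rewrite {1}eQ hornerC.
  have h1 : (t0 <= t)%N by apply: leq_trans ht; apply: leq_addr.
  have h2 : (t0 <= t - s)%N by rewrite leq_subRL // addnC.
  by apply/eqP; rewrite -(eqr_nat rat) (hQ _ h1) (hQ _ h2) !ev.
by rewrite h //; lia.
Qed.

Lemma hilbert_poly_sub hA hB hC s D a b :
  (forall t, (s <= t)%N -> hA t = hB t + hC (t - s))%N ->
  hilbert_poly hA D a -> hilbert_poly hC D b -> hilbert_poly hB D (a - b).
Proof.
move=> h [Q [t0 [hQ sQ <-]]] [Q' [t1 [hQ' sQ' <-]]].
have [sd cd] := backward_shift_top s sQ'.
exists (Q - backward_shift s Q'), (t0 + t1 + s)%N; split=> [t ht||].
- have st : (s <= t)%N by apply: leq_trans ht; apply: leq_addl.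
  rewrite hornerD hornerN horner_backward_shift -natrB // -hQ -?hQ'; try lia.
  by rewrite h // natrD addrK.
- by rewrite (leq_trans (size_polyD _ _)) // size_polyN geq_max sQ.
by rewrite coefB cd mulrBl.
Qed.

(** Otherwise the leading term beats all others, which are bounded by S times
    the previous power of t. *)
Lemma poly_eventually_ge0 Q D t0 : (size Q <= D.+1)%N ->
  (forall t, (t0 <= t)%N -> 0 <= Q.[t%:R]) -> 0 <= Q`_D.
Proof.
move=> sQ hQ; rewrite leNgt; apply/negP => neg.
pose S := \sum_(i < D) `|Q`_i|.
have S_ge0 : 0 <= S by apply: sumr_ge0 => i _; apply: normr_ge0.
pose N := Num.bound (S / - Q`_D); pose t := (t0 + N).+1.
have t_gt0 : 0 < t%:R :> rat by rewrite ltr0n.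
have tN : S / - Q`_D < t%:R.
  apply: lt_le_trans (archi_boundP _) _; first by rewrite divr_ge0 // oppr_ge0 ltW.
  by rewrite ler_nat leqW // leq_addl.
have := hQ t (leq_trans (leq_addr N t0) (leqnSn _)).
rewrite (horner_coef_wide _ sQ) big_ord_recr /=.
suff : (\sum_(i < D) Q`_i * t%:R ^+ i) * t%:R <= S * t%:R ^+ D.
  move=> h1 h2; have := mulr_ge0 h2 (ltW t_gt0).
  rewrite mulrDl => h3.
  have : 0 <= (S + Q`_D * t%:R) * t%:R ^+ D.
    apply: le_trans h3 _; rewrite mulrDl; apply: lerD => //.
    by rewrite -mulrA [_ ^+ D * _]mulrC mulrA.
  rewrite pmulr_lge0 ?exprn_gt0 //; move: tN.
  rewrite ltr_pdivrMr ?oppr_gt0 // mulrN => h4; lra.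
rewrite mulr_suml mulr_suml; apply: ler_sum => i _.
rewrite -mulrA -exprSr; apply: le_trans (ler_norm _) _.
rewrite normrM; apply: ler_wpM2l; first exact: normr_ge0.
rewrite ger0_norm; last by rewrite exprn_ge0 // ltW.
apply: ler_weXn2l; first by rewrite ler1n.
exact: ltn_ord.
Qed.

Lemma hilbert_poly_le h1 h2 D a1 a2 : (forall t, (h1 t <= h2 t)%N) ->
  hilbert_poly h1 D a1 -> hilbert_poly h2 D a2 -> a1 <= a2.
Proof.
move=> h [Q1 [t1 [hQ1 s1 <-]]] [Q2 [t2 [hQ2 s2 <-]]].
rewrite -subr_ge0 -mulrBl -coefB mulr_ge0 ?ler0n //.
apply: (@poly_eventually_ge0 _ _ (t1 + t2)).
  by rewrite (leq_trans (size_polyD _ _)) // size_polyN geq_max s1 s2.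
move=> t ht; rewrite hornerD hornerN subr_ge0 -hQ1 -?hQ2 ?ler_nat //; lia.
Qed.

Lemma hilbert_poly_drop h D a : hilbert_poly h D a -> hilbert_poly h D.+1 0.
Proof.
move=> [Q [t0 [hQ sQ _]]]; exists Q, t0; split=> //; first exact: leq_trans sQ _.
by rewrite nth_default // mul0r.
Qed.

Lemma hilbert_poly_zero h D : (exists t0, forall t, (t0 <= t)%N -> h t = 0%N) ->
  hilbert_poly h D 0.
Proof.
move=> [t0 ht]; exists 0, t0; split=> [t /ht ->||]; rewrite ?horner0 ?size_poly0 //.
by rewrite coef0 mul0r.
Qed.

Lemma hilbert_poly_binomial D : hilbert_poly (fun t => 'C(t + D, t)) D 1.
Proof.
pose P : {poly rat} := \prod_(i < D) ('X - (- (D - i)%:R)%:P).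
have sP : size P = D.+1 by rewrite size_prod_XsubC /index_enum -enumT size_enum_ord.
have fD : D`!%:R != 0 :> rat by rewrite pnatr_eq0 -lt0n fact_gt0.
exists (D`!%:R^-1 *: P), 0%N; split=> [t _||].
- apply: (mulfI fD); rewrite hornerZ mulrA divff // mul1r horner_prod -natrM.
  have -> : 'C(t + D, t) = 'C(t + D, D) by rewrite -(bin_sub (leq_addl t D)) addnK.
  rewrite mulnC bin_ffact ffact_prod natr_prod; apply: eq_bigr => i _.
  by rewrite hornerXsubC opprK -natrD addnBA // ltnW.
- by rewrite (leq_trans (size_scale_leq _ _)) // sP.
have /monicP : P \is monic by apply: monic_prod_XsubC.
by rewrite /lead_coef sP coefZ /= => ->; rewrite mulr1 mulVf.
Qed.

End EventuallyPolynomial.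

(** * Hilbert polynomials of regular sequences *)

Section RegularSequenceHilbert.
Variable k : fieldType.

(** Stated for an arbitrary ideal with no nonzero element, since the span of
    the empty family is zero only extensionally. *)
Lemma hilb_zero_ideal m D t (J : {mpoly k[m]} -> Prop) : m = D.+1 ->
  ideal_like J -> (forall p, J p -> p = 0) -> hilb J t = 'C(t + D, t).
Proof.
move=> em; subst m; move=> iJ J0; pose V := dhomog D.+1 k t.
have -> : 'C(t + D, t) = \dim {: V} by rewrite dimvf.
apply: hilb_unique => //; apply/graded_dimP => //.
pose B := vbasis {: V}; exists (fun i => val (B`_i)).
have combE c : comb (fun i => val B`_i) c = val (\sum_i c i *: B`_i).
  rewrite /comb (raddf_sum (@mpoly_of_dhomog _ _ _)); apply: eq_bigr => i _.
  by [].
split; [split=> [i|p hp] | move=> c hc].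
- exact: dhomog_is_dhomog.
- exists (fun i => coord B i (DHomog hp)).
  by rewrite combE -coord_vbasis ?memvf //= subrr; case: iJ.
have /freeP := basis_free (vbasisP {: V}); apply.
by apply: val_inj; rewrite -/B -combE /=; apply: J0.
Qed.

Variables (m n : nat) (d : 'I_n -> nat) (f : 'I_n -> {mpoly k[m]}).
Local Notation R := {mpoly k[m]}.
Hypothesis f_homog : forall i, f i \is (d i).-homog.
Hypothesis f_regular : regular_sequence f.

Definition initial_ideal (i : nat) : R -> Prop :=
  Defs.span (fun j : 'I_n => (j < i)%N) f.

Lemma initial_graded i : graded_ideal (initial_ideal i).
Proof. exact: span_graded f_homog. Qed.

Lemma initial_ideal_like i : ideal_like (initial_ideal i).
Proof. by case: (initial_graded i). Qed.

Lemma initial_sub_ideal i p : initial_ideal i p -> ideal f p.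
Proof. by apply: span_sub => j _; apply: span_mem. Qed.

Lemma initial_ideal_all p : initial_ideal n p <-> ideal f p.
Proof.
split; first exact: initial_sub_ideal.
by apply: span_sub => j _; apply: span_mem.
Qed.

Lemma initial_adjoin (x : 'I_n) p :
  initial_ideal x.+1 p <-> adjoin (initial_ideal x) (f x) p.
Proof.
split=> [[a ->]|[q h]].
  exists (a x); rewrite (bigD1 x) //= addrAC subrr add0r.
  apply: span_sum => j /andP[jx nj]; apply: spanM; apply: span_mem.
  by rewrite ltn_neqAle nj -ltnS.
rewrite -[p](subrK (q * f x)); apply: spanD.
  by apply: span_sub h => j jx; apply: span_mem; apply: ltnW.
by apply: spanM; apply: span_mem.
Qed.

Lemma initial_regular (x : 'I_n) q :
  initial_ideal x (q * f x) <-> initial_ideal x q.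
Proof.
split; first by case: f_regular => h _; apply: h.
by rewrite mulrC; apply: spanM.
Qed.

Lemma hilb_initialS (x : 'I_n) t : (d x <= t)%N ->
  hilb (initial_ideal x) t =
    (hilb (initial_ideal x.+1) t + hilb (initial_ideal x) (t - d x))%N.
Proof.
move=> dt; rewrite (hilb_adjoin_ge (initial_graded x) (initial_ideal_like x)
  (f_homog x) (initial_regular x)) //.
congr (_ + _)%N; apply: hilb_iff; last by move=> p; rewrite initial_adjoin.
  exact: adjoin_ideal_like (initial_graded x).
exact: initial_ideal_like.
Qed.

Lemma hilb_initialS_lt (x : 'I_n) t : (t < d x)%N ->
  hilb (initial_ideal x) t = hilb (initial_ideal x.+1) t.
Proof.
move=> dt; rewrite (hilb_adjoin_lt (initial_graded x) (f_homog x)) //.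
apply: hilb_iff; last by move=> p; rewrite initial_adjoin.
  exact: adjoin_ideal_like (initial_graded x).
exact: initial_ideal_like.
Qed.

Lemma regular_not_constant i : ~ f i \is 0.-homog.
Proof.
move=> h0; have [reg proper] := f_regular.
have ec : f i = (mcoeff 0%MM (f i))%:MP.
  apply/mpolyP => u; rewrite mcoeffC; have [->|nu] := eqVneq u 0%MM.
    by rewrite mulr1.
  by rewrite mulr0 (dhomog_nemf_coeff h0) // mdeg_eq0.
have [z|nz] := eqVneq (mcoeff 0%MM (f i)) 0; apply: proper.
  apply: (@initial_sub_ideal i); apply: reg; rewrite mul1r ec z mpolyC0.
  exact: span0.
have -> : 1 = ((mcoeff 0%MM (f i))^-1)%:MP * f i by rewrite {2}ec -mpolyCM mulVf.
by apply: spanM; apply: span_mem.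
Qed.

Lemma regular_degree_gt0 i : (0 < d i)%N.
Proof.
rewrite lt0n; apply/eqP => d0; apply: (@regular_not_constant i).
by have := f_homog i; rewrite d0.
Qed.

Lemma prod_initialS (x : 'I_n) :
  (\prod_(j < n | (j < x.+1)%N) d j = d x * \prod_(j < n | (j < x)%N) d j)%N.
Proof.
rewrite (bigD1 x) //=; congr (_ * _)%N; apply: eq_bigl => j.
by rewrite ltnS -val_eqE /= ltn_neqAle andbC.
Qed.

Lemma hilbert_poly_initial i D : (i <= n)%N -> m = (i + D.+1)%N ->
  hilbert_poly (hilb (initial_ideal i)) D (\prod_(j < n | (j < i)%N) d j)%N%:R.
Proof.
elim: i D => [|i IH] D ilen em.
  have em' : m = D.+1 by [].
  rewrite big_pred0 //; have [Q [t0 [hQ sQ lQ]]] := hilbert_poly_binomial D.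
  exists Q, t0; split=> // t ht; rewrite -hQ //; congr (_%:R).
  apply: hilb_zero_ideal; [exact: em' | exact: initial_ideal_like |].
  by move=> p [a ->]; rewrite big_pred0.
pose x := Ordinal ilen.
rewrite (prod_initialS x) natrM.
apply: (@hilbert_poly_adjoin (hilb (initial_ideal x))) => [t|].
  exact: (@hilb_initialS x).
by apply: IH; [exact: ltnW | rewrite em addSnnS].
Qed.

Lemma hilb_initial_eventually0 (x : 'I_n) : m = x.+1 ->
  exists t0, forall t, (t0 <= t)%N -> hilb (initial_ideal x.+1) t = 0%N.
Proof.
move=> em; apply: (@hilbert_poly_adjoin0 (hilb (initial_ideal x)) _ (d x)) => [t|].
  exact: hilb_initialS.
by apply: hilbert_poly_initial; [exact: ltnW | rewrite addn1].
Qed.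

Lemma hilb0 (J : R -> Prop) t p : ideal_like J -> hilb J t = 0%N ->
  p \is t.-homog -> J p.
Proof.
move=> iJ h0 hp; have := hilbP t iJ; rewrite h0 => -[b [_ ub]].
have [c [+ _]] := ub p hp; by rewrite big_ord0 subr0.
Qed.

(** Modulo the first m members of a regular sequence the ring has finite
    length.  A further member would be nilpotent, hence could not be regular. *)
Lemma regular_length : (n <= m)%N.
Proof.
rewrite leqNgt; apply/negP => mn.
have [m0|m_gt0] := posnP m.
  by apply: (@regular_not_constant (Ordinal mn)); apply: nvar0_homog_eq.
pose x := Ordinal mn.
have mn' : (m.-1 < n)%N by rewrite prednK // ltnW.
have [|t0 ht] := @hilb_initial_eventually0 (Ordinal mn'); first by rewrite /= prednK.
have pw t : initial_ideal x (f x ^+ t) -> initial_ideal x 1.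
  elim: t => // t IH; rewrite exprSr => h; apply: IH; exact/initial_regular.
have [_ proper] := f_regular; apply: proper.
apply: (@initial_sub_ideal x); apply: (pw t0).
apply: (@hilb0 _ (d x * t0)%N); [exact: initial_ideal_like | |exact: dhomogMn].
rewrite -[nat_of_ord x](prednK m_gt0); apply: ht.
by rewrite leq_pmull // regular_degree_gt0.
Qed.

End RegularSequenceHilbert.

(** * Multiplicity of the linked ideal *)

Section MultiplicityOfHilbertPoly.
Variables (k : fieldType) (m : nat).
Local Notation R := {mpoly k[m]}.
Implicit Types (J : R -> Prop) (P Q : {poly rat}).

(** Applying the positivity of leading coefficients to the difference and to
    its opposite shows that the leading coefficient of the difference is 0. *)
Lemma poly_eventually_eq P Q t0 :
  (forall t, (t0 <= t)%N -> P.[t%:R] = Q.[t%:R]) -> P = Q.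
Proof.
move=> h; apply/eqP; rewrite -subr_eq0 -lead_coef_eq0; apply/eqP.
have ge0 P1 P2 : (forall t, (t0 <= t)%N -> P1.[t%:R] = P2.[t%:R]) ->
    0 <= (P1 - P2)`_(size (P1 - P2)).-1.
  move=> h'; apply: (@poly_eventually_ge0 _ _ t0); first by case: (size _).
  by move=> t ht; rewrite hornerD hornerN h' ?subrr.
apply/eqP; rewrite eq_le; apply/andP; split; last exact: ge0.
have := ge0 Q P (fun t ht => esym (h t ht)).
by rewrite -(opprB P Q) size_polyN coefN oppr_ge0.
Qed.

(** The multiplicity is chosen among all numbers that satisfy its definition,
    so that one instance is needed to know that it satisfies the definition at
    all; the Hilbert polynomial does not depend on the instance, but in finite
    length the bound on the degrees does. *)
Lemma multiplicity_spec J H Q t0 mu : ideal_like J ->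
  (forall t, hilb J t = H t) -> (forall t, (t0 <= t)%N -> (H t)%:R = Q.[t%:R]) ->
  (if Q == 0 then mu = (\sum_(t < t0) H t)%N
   else mu%:R = lead_coef Q * ((size Q).-1)`!%:R) ->
  exists t1, if Q == 0 then multiplicity J = (\sum_(t < t1) H t)%N
    else (multiplicity J)%:R = lead_coef Q * ((size Q).-1)`!%:R.
Proof.
move=> iJ hH hQ hmu.
have [] : is_multiplicity J (multiplicity J).
  apply: epsilon_spec; exists mu, H, Q, t0; split=> // t.
  by rewrite -hH; apply: hilbP.
move=> H' [Q' [t1 [hH' hQ' hmu']]].
have eH t : H' t = H t by rewrite -hH; apply/esym/hilb_unique.
have eQ : Q' = Q.
  by apply: (@poly_eventually_eq _ _ (t0 + t1)) => t ht; rewrite -hQ -?hQ' ?eH //; lia.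
exists t1; rewrite eQ in hmu'; move: hmu'; case: eqP => // _ ->.
by apply: eq_bigr => t _.
Qed.

Lemma multiplicity_hilbert_poly J D (a : nat) : ideal_like J -> (0 < a)%N ->
  hilbert_poly (hilb J) D a%:R -> multiplicity J = a.
Proof.
move=> iJ a_gt0 [Q [t0 [hQ sQ lQ]]].
have QD : Q`_D != 0.
  by apply: contraTneq a_gt0 => QD; move: lQ; rewrite QD mul0r => /esym/eqP;
    rewrite pnatr_eq0 => /eqP ->.
have sizeQ : size Q = D.+1.
  apply/eqP; rewrite eqn_leq sQ ltnNge; apply: contra QD => sQ'.
  by rewrite nth_default.
have Q0 : Q != 0 by rewrite -size_poly_eq0 sizeQ.
have [|t1] := @multiplicity_spec J (hilb J) Q t0 a iJ (fun=> erefl) hQ.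
  by rewrite (negPf Q0) /lead_coef sizeQ lQ.
rewrite (negPf Q0) /lead_coef sizeQ lQ => /eqP; by rewrite eqr_nat => /eqP.
Qed.

Lemma multiplicity_finite_length J t0 : ideal_like J ->
  (forall t, (t0 <= t)%N -> hilb J t = 0%N) ->
  exists t1, multiplicity J = (\sum_(t < t1) hilb J t)%N.
Proof.
move=> iJ h0.
have [|||t1] := @multiplicity_spec J (hilb J) 0 t0 (\sum_(t < t0) hilb J t)%N iJ.
- by [].
- by move=> t /h0 ->; rewrite horner0.
- by rewrite eqxx.
by rewrite eqxx => ->; exists t1.
Qed.

End MultiplicityOfHilbertPoly.

(** The Hilbert function of the ideal is the difference of h and its translate
    by d x, where h is the Hilbert function modulo all members but the last.  Its
    partial sums telescope to d x values of h, which is eventually constant. *)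
Lemma length_complete_intersection (k : fieldType) m n (d : 'I_n -> nat)
    (f : 'I_n -> {mpoly k[m]}) N :
  homogeneous_regular_sequence d f -> m = n -> (0 < n)%N ->
  (\sum_(t < N) hilb (ideal f) t <= \prod_(j < n) d j)%N.
Proof.
move=> [hf rf] emn n_gt0.
have xn : (n.-1 < n)%N by rewrite prednK.
pose x := Ordinal xn; pose h := hilb (initial_ideal f x).
pose P := (\prod_(j < n | (j < x)%N) d j)%N.
have [Q [t0 [hQ sQ lQ]]] : hilbert_poly h 0 P%:R.
  by apply: hilbert_poly_initial => //; [exact: ltnW | rewrite addn1 prednK].
have ht t : (t0 <= t)%N -> h t = P.
  move=> ht; apply/eqP; rewrite -(eqr_nat rat) hQ // -lQ.
  by rewrite {1}(size1_polyC sQ) hornerC mulr1.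
have eh t : hilb (ideal f) t = hilb (initial_ideal f x.+1) t.
  apply: hilb_iff.
  - by case: (span_graded predT hf).
  - exact: initial_ideal_like hf _.
  by move=> p; rewrite /x /= prednK // initial_ideal_all.
have sumM M : (\sum_(t < M + d x) hilb (ideal f) t + \sum_(t < M) h t =
    \sum_(t < M + d x) h t)%N.
  elim: M => [|M IH].
    rewrite add0n big_ord0 addn0; apply: eq_bigr => t _.
    by rewrite eh /h (hilb_initialS_lt hf).
  rewrite addSn !big_ord_recr /= addnACA IH; congr (_ + _)%N.
  by rewrite eh /h [in RHS](hilb_initialS hf rf) ?leq_addl // addnK.
have eP : (\prod_(j < n) d j = d x * P)%N.
  rewrite -(prod_initialS d x); apply: eq_bigl => j.
  by rewrite /x /= prednK // ltn_ord.
pose M := (N + t0)%N.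
apply: (@leq_trans (\sum_(t < M + d x) hilb (ideal f) t)%N).
  have NM : (N <= M + d x)%N by rewrite /M; lia.
  rewrite (big_ord_widen _ (fun t => hilb (ideal f) t) NM).
  rewrite [leqRHS](bigID (fun t : 'I__ => (t < N)%N)) /=; exact: leq_addr.
rewrite -(leq_add2r (\sum_(t < M) h t)) sumM big_split_ord /= addnC leq_add2r.
rewrite (eq_bigr (fun=> P)) => [|j _]; last by apply: ht; rewrite /M; lia.
by rewrite sum_nat_const card_ord eP.
Qed.

Section LinkedIdeal.
Variables (k : fieldType) (m n : nat) (d e : 'I_n -> nat).
Variables (f g : 'I_n -> {mpoly k[m]}) (phi : {set 'I_n} -> {set 'I_n} -> {mpoly k[m]}).
Local Notation R := {mpoly k[m]}.
Local Notation J := (colon (ideal g) (ideal f)).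
Hypothesis hf : homogeneous_regular_sequence d f.
Hypothesis hg : homogeneous_regular_sequence e g.
Hypothesis hphi : lifts_inclusion d e f g phi.
Let rows (S : {set 'I_n}) : {ffun {set 'I_n} -> R} := [ffun T : {set 'I_n} => phi S T].
Let rows_chain : @chain_map k m (koszul e g) (koszul d f) rows := phi_row_chain hphi.
Let rows0 : rows set0 set0 = 1 := phi_row0 hphi.

(** The chain map condition on [set a], as phi is 1 in degree 0. *)
Lemma generator_expansion a : g a = \sum_t phi [set a] [set t] * f t.
Proof.
have e0 := act_diff_set1 e g a
  (etrans (row_set0 rows_chain) (congr1 (@scalar_chain k m n) rows0)).
have [_ c] := rows_chain.
have := congr1 (fun v : {ffun {set 'I_n} -> R} => v set0) (c [set a]).
rewrite e0 koszul_bd_set0 ffunE eqxx mulr1 => ->.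
by apply: eq_bigr => t _; rewrite ffunE.
Qed.

Lemma phi_set1_homog a t :
  homog_of_deg ((e a)%:Z - (d t)%:Z) (phi [set a] [set t]).
Proof. by have [[_ h _] _] := hphi; have := h [set a] [set t]; rewrite /= !big_set1. Qed.

Lemma phi_set1_eq0 a t : (e a < d t)%N -> phi [set a] [set t] = 0.
Proof.
move=> lt; have [r er] : exists r, (e a)%:Z - (d t)%:Z = Negz r.
  by exists (d t - e a).-1; rewrite NegzE; lia.
by have := @phi_set1_homog a t; rewrite er => /homog_of_deg_neg.
Qed.

(** If e i < d i, then for reasons of degree the first i.+1 members of g lie in
    the ideal of the first i members of f.  The quotient by the latter has the
    smaller Hilbert function, but its Hilbert polynomial has degree m - i - 1,
    against at most m - i - 2 for the quotient by the former. *)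
Lemma degree_le (hd : forall i j : 'I_n, (i <= j)%N -> (d i <= d j)%N)
    (he : forall i j : 'I_n, (i <= j)%N -> (e i <= e j)%N) i : (d i <= e i)%N.
Proof.
have [fh fr] := hf; have [gh gr] := hg.
rewrite leqNgt; apply/negP => lt.
have sub p : initial_ideal g i.+1 p -> initial_ideal f i p.
  apply: span_sub => a ai; rewrite generator_expansion; apply: span_sum => t _.
  have [ti|it] := ltnP t i; first by apply/spanM/span_mem.
  rewrite phi_set1_eq0 ?mul0r; first exact: span0.
  exact: leq_ltn_trans (he _ _ ai) (leq_trans lt (hd _ _ it)).
have im : (i < m)%N := leq_trans (ltn_ord i) (regular_length fh fr).
have em : m = (i + (m - i.+1).+1)%N by lia.
have hF := @hilbert_poly_initial _ _ _ _ _ fh fr i _ (ltnW (ltn_ord i)) em.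
(* For m = i.+1 the quotient by the members of g has finite length. *)
have hG : hilbert_poly (hilb (initial_ideal g i.+1)) (m - i.+1) 0.
  have [im1|im1] := ltnP i.+1 m.
    have -> : (m - i.+1 = (m - i.+2).+1)%N by lia.
    apply: hilbert_poly_drop; apply: (hilbert_poly_initial gh gr) => //; lia.
  by apply/hilbert_poly_zero/(hilb_initial_eventually0 gh gr); lia.
have le t := hilb_anti t (initial_ideal_like gh _) (initial_ideal_like fh _) sub.
have := hilbert_poly_le le hF hG; apply/negP.
rewrite -ltNge ltr0n; apply: prodn_cond_gt0 => j _; exact: regular_degree_gt0 fh fr j.
Qed.

(** An entry of phi in positive homological degree is an entry of the
    differential of the cone, hence is not a nonzero constant.  As the first
    member of g is nonzero, its expansion has a nonzero entry, of positive
    degree. *)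
Lemma degree_lt (hd : forall i j : 'I_n, (i <= j)%N -> (d i <= d j)%N)
    (hP : is_minimal (dual_cone d e f g phi)) (n_gt0 : (0 < n)%N) :
  (d (Ordinal n_gt0) < e (Ordinal n_gt0))%N.
Proof.
have [fh fr] := hf; have [gh gr] := hg; set x := Ordinal n_gt0.
have [t nz] : exists t, phi [set x] [set t] != 0.
  apply/existsP; apply: contraT => /existsPn h0.
  case: (@regular_not_constant _ _ _ _ gr x).
  rewrite generator_expansion big1 ?dhomog0 // => t _.
  by move/negPn/eqP: (h0 t) => ->; rewrite mul0r.
have hom := @phi_set1_homog x t.
have dx : (d x <= d t)%N by apply: hd.
have [lt|le] := leqP (e x) (d t); last exact: leq_ltn_trans dx le.
case/eqP: nz; have [eq|ne] := eqVneq (e x) (d t); last first.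
  by apply: phi_set1_eq0; rewrite ltn_neqAle ne.
have nB : ~: [set x] != setT.
  by apply/eqP => /setP/(_ x); rewrite !inE eqxx.
have nT : [set t] != set0 by apply/eqP => /setP/(_ t); rewrite !inE eqxx.
have := hP (inr (exist _ [set t] nT)) (inl (exist _ (~: [set x]) nB)).
rewrite /= setCK => c0; apply/mpolyP => u; rewrite mcoeff0.
have [->//|nu] := eqVneq u 0%MM; apply/eqP; rewrite mcoeff_eq0.
by apply: contra nu => /hom; rewrite eq subrr => -[/eqP]; rewrite mdeg_eq0.
Qed.

Lemma prod_degree_lt (hd : forall i j : 'I_n, (i <= j)%N -> (d i <= d j)%N)
    (he : forall i j : 'I_n, (i <= j)%N -> (e i <= e j)%N)
    (hP : is_minimal (dual_cone d e f g phi)) (n_gt0 : (0 < n)%N) :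
  (\prod_i d i < \prod_i e i)%N.
Proof.
have [gh gr] := hg.
rewrite (bigD1 (Ordinal n_gt0)) //= [ltnRHS](bigD1 (Ordinal n_gt0)) //=.
have le : (\prod_(i | i != Ordinal n_gt0) d i <= \prod_(i | i != Ordinal n_gt0) e i)%N.
  by apply: leq_prod => i _; apply: degree_le.
apply: leq_ltn_trans (leq_mul (leqnn _) le) _.
rewrite ltn_pmul2r; first exact: degree_lt.
by apply: prodn_cond_gt0 => j _; exact: regular_degree_gt0 gh gr j.
Qed.

(** The shift s is the degree of delta, which is nonzero since R/I is. *)
Lemma link_hilb : exists s, forall t, (s <= t)%N ->
  hilb (ideal g) t = (hilb J t + hilb (ideal f) (t - s))%N.
Proof.
have [fh fr] := hf; have [gh gr] := hg.
pose delta := rows setT setT.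
have inj q : ideal g (q * delta) -> ideal f q :=
    @link_injective _ _ _ _ _ _ _ gr _ rows_chain rows0 q.
have mem q : ideal f q -> ideal g (q * delta).
  move=> [a ->]; rewrite mulr_suml; apply: span_sum => i _; rewrite -mulrA.
  exact/spanM/(mul_delta_mem rows_chain).
have [s hs] : exists s, delta \is s.-homog.
  have [[_ h _] _] := hphi; have := h setT setT; rewrite /delta ffunE.
  case: (gshift _ - _) => s; first by move/homog_of_deg_nat; exists s.
  move/homog_of_deg_neg => z; case: (proj2 fr); apply: inj.
  by rewrite /delta ffunE z mulr0; apply: span0.
have gK : graded_ideal (ideal g) := span_graded predT gh.
have iI : ideal_like (ideal f) := proj1 (span_graded predT fh).
exists s => t st; rewrite (hilb_adjoin_ge gK iI hs) // => [|q]; last first.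
  by split; [apply: inj | apply: mem].
congr (_ + _)%N; apply: hilb_iff.
- exact: adjoin_ideal_like gK.
- exact: (proj1 (colon_graded fh gh)).
by move=> p; rewrite (link_colon fr gr rows_chain rows0).
Qed.

(** In the case m = n the ring R/J has finite length and the bound comes from
    K being contained in J.  In the case m > n the multiplicity is the
    difference of the two products, once this difference is nonzero. *)
Lemma multiplicity_link_le (hd : forall i j : 'I_n, (i <= j)%N -> (d i <= d j)%N)
    (he : forall i j : 'I_n, (i <= j)%N -> (e i <= e j)%N)
    (hP : is_minimal (dual_cone d e f g phi)) (n_gt0 : (0 < n)%N) :
  (multiplicity J <= \prod_i e i)%N.
Proof.
have [fh fr] := hf; have [gh gr] := hg.
have iJ := proj1 (colon_graded fh gh).
have gK : ideal_like (ideal g) := proj1 (span_graded predT gh).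
have hilb_ideal (f1 : 'I_n -> R) (d1 : 'I_n -> nat) : homogeneous_regular_sequence d1 f1 ->
    forall D, m = (n + D.+1)%N ->
    hilbert_poly (hilb (ideal f1)) D (\prod_i d1 i)%N%:R.
  move=> [h1 r1] D em; have [Q [t0 [hQ sQ lQ]]] := hilbert_poly_initial h1 r1 (leqnn n) em.
  exists Q, t0; split=> // [t ht|].
    rewrite -hQ //; congr (_%:R); apply: hilb_iff.
    - by case: (span_graded predT h1).
    - exact: initial_ideal_like h1 _.
    by move=> p; rewrite initial_ideal_all.
  rewrite lQ; congr (_%:R); apply: eq_bigl => j; by rewrite ltn_ord.
have := regular_length fh fr; rewrite leq_eqVlt => /orP[/eqP emn|nm].
  have sub p : ideal g p -> J p.
    by move=> hp q _; rewrite mulrC; apply: spanM.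
  have xn : (n.-1 < n)%N by rewrite prednK.
  have [|t0 h0] := @hilb_initial_eventually0 _ _ _ _ _ gh gr (Ordinal xn).
    by rewrite /= prednK.
  have [t ht|t1 ->] := @multiplicity_finite_length _ _ J t0 iJ.
    apply/eqP; rewrite -leqn0 -(h0 t ht) /= prednK //.
    apply: (hilb_anti t _ iJ); first exact: initial_ideal_like gh _.
    by move=> p /initial_ideal_all /sub.
  apply: leq_trans (length_complete_intersection t1 hg (esym emn) n_gt0).
  by apply: leq_sum => t _; apply: hilb_anti.
have em : m = (n + (m - n.+1).+1)%N by lia.
have [s hs] := link_hilb.
have := hilbert_poly_sub hs (hilb_ideal _ _ hg _ em) (hilb_ideal _ _ hf _ em).
have lt := prod_degree_lt hd he hP n_gt0.
rewrite -natrB; last exact: ltnW.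
move/(multiplicity_hilbert_poly iJ) => ->; [exact: leq_subr | by rewrite subn_gt0].
Qed.

Lemma max_shift_ge (F : graded_free k m) M (a : dual_cone d e f g phi) i :
  (1 < n)%N ->
  is_minimal (dual_cone d e f g phi) ->
  is_minimal_free_resolution J F -> is_max_shift F i M -> hdeg a = i ->
  gshift a <= M.
Proof.
move=> n_gt1 hP [hF _] [_ hM] ha; have [fh fr] := hf; have [gh gr] := hg.
have resP := dual_cone_resolution n_gt1 fh gh fr gr hphi.
have [b hb <-] := minimal_resolution_shift (colon_graded fh gh) (conj resP hP) hF a.
by apply: hM; rewrite hb.
Qed.

End LinkedIdeal.


(** * The bound *)

Theorem theorem4p1 (k : fieldType) (m n : nat) (hn : (1 < n)%N)
  (d e : 'I_n -> nat) (f g : 'I_n -> {mpoly k[m]})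
  (hf : homogeneous_regular_sequence d f)
  (hd : forall i j : 'I_n, (i <= j)%N -> (d i <= d j)%N)
  (hg : homogeneous_regular_sequence e g)
  (he : forall i j : 'I_n, (i <= j)%N -> (e i <= e j)%N)
  (hKI : forall p : {mpoly k[m]}, ideal g p -> ideal f p)
  (phi : {set 'I_n} -> {set 'I_n} -> {mpoly k[m]})
  (hphi : lifts_inclusion d e f g phi)
  (hP : is_minimal (dual_cone d e f g phi))
  (hde : (d (Ordinal (ltnW hn)) <=
          \sum_(i < n | (0 < i)%N) (e i - e (Ordinal (ltnW hn))))%N)
  (F : graded_free k m)
  (hF : is_minimal_free_resolution (colon (ideal g) (ideal f)) F)
  (M : nat -> int)
  (hM : forall i : nat, (1 <= i <= n)%N -> is_max_shift F i (M i)) :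
  (multiplicity (colon (ideal g) (ideal f)))%:R <=
    (\prod_(1 <= i < n.+1) (M i)%:~R) / n`!%:R :> rat.
Proof.
set x := Ordinal (ltnW hn) in hde *.
have shift a i : (1 <= i <= n)%N -> hdeg (a : dual_cone d e f g phi) = i ->
    gshift a <= M i.
  by move=> hi; apply: (max_shift_ge hf hg hphi hn hP hF (hM i hi)).
have bound (i : 'I_n) : ((i.+1 * e (rev_ord i))%N%:Z <= M i.+1).
  have [lt|ge] := ltnP i.+1 n.
    (* The generator of step i.+1 indexed by the i.+1 largest degrees. *)
    pose B := ~: initial n (rev_ord i).
    have cB : #|B| = i.+1.
      rewrite cardsCs setCK card_ord card_initial; last exact: ltnW (ltn_ord _).
      by rewrite subKn // ltnW.
    have nB : B != setT.
      by apply: contraTneq lt => eB; rewrite -cB eB cardsT card_ord ltnn.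
    apply: le_trans (shift (inl (exist _ B nB)) i.+1 _ cB); last by rewrite /= ltn_ord.
    rewrite lez_nat -cB -sum_nat_const; apply: leq_sum => t; rewrite !inE -leqNgt.
    exact: he.
  (* In the last step, the dual basis element of the generator of least degree
     of I, of shift alpha - d_1. *)
  have nT : [set x] != set0 by apply/eqP => /setP/(_ x); rewrite !inE eqxx.
  have ei : i.+1 = n by apply/eqP; rewrite eqn_leq ge ltn_ord.
  have ex : rev_ord i = x by apply: val_inj; rewrite /= ei subnn.
  apply: le_trans (shift (inr (exist _ [set x] nT)) i.+1 _ _).
  - rewrite /= big_set1 ex ei lerBrDr -PoszD lez_nat.
    apply: (@leq_trans (\sum_(t < n) (e x + (e t - e x)))%N); last first.
      by apply: leq_sum => t _; rewrite subnKC //; apply: he.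
    rewrite big_split /= sum_nat_const card_ord leq_add2l.
    apply: leq_trans hde _; rewrite [leqRHS](bigID (fun t : 'I_n => (0 < t)%N)) /=.
    exact: leq_addr.
  - by rewrite /= ltn_ord.
  by rewrite /= cards1 subn1 ei.
have mult := multiplicity_link_le hf hg hphi hd he hP (ltnW hn).
have nf : 0 < n`!%:R :> rat by rewrite ltr0n fact_gt0.
rewrite ler_pdivlMr // -natrM.
apply: (@le_trans _ _ (\prod_(i < n) (i.+1 * e (rev_ord i))%N%:R)).
  rewrite -natr_prod ler_nat big_split /= mulnC fact_prod big_add1 /= big_mkord.
  rewrite leq_mul2l; apply/orP; right.
  by rewrite -(reindex_inj rev_ord_inj (F := e) (P := xpredT)).
rewrite big_add1 /= big_mkord; apply: ler_prod => i _; rewrite ler0n /=.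
by rewrite -[_%:R]/((i.+1 * e (rev_ord i))%N%:Z%:~R) ler_int.
Qed.
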